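(* Let $\star\in\{\top,*\}$, let $A\in\mathbb{C}^{p\times m}$, $B\in\mathbb{C}^{n\times q}$, $C\in\mathbb{C}^{p\times n}$ and $D\in\mathbb{C}^{m\times q}$, and set $$\mathcal{Q}(\lambda):=\begin{bmatrix}\lambda D^\star & B^\star\\ A & \lambda C\end{bmatrix}.$$ The equation $$AXB+CX^\star D=E$$ in the unknown $X\in\mathbb{C}^{m\times n}$ has a unique solution for any right-hand side $E\in\mathbb{C}^{p\times q}$ if and only if the pencil $\mathcal{Q}(\lambda)$ is regular and one of the following situations holds: (1) $p=m\neq n=q$, either $m<n$ and $A$ is invertible or $m>n$ and $B$ is invertible, and - if $\star=\top$: $\widehat\Lambda(\mathcal{Q})\setminus\{1,-1\}$ is reciprocal free and $m_1(\mathcal{Q})=m_{-1}(\mathcal{Q})\leq 1$; - if $\star=*$: $\widehat\Lambda(\mathcal{Q})$ is $*$-reciprocal free. (2) $p=n\neq m=q$, either $m>n$ and $C$ is invertible or $m<n$ and $D$ is invertible, and - if $\star=\top$: $\widetilde\Lambda(\mathcal{Q})\setminus\{1,-1\}$ is reciprocal free and $m_1(\mathcal{Q})=m_{-1}(\mathcal{Q})\leq 1$; - if $\star=*$: $\widetilde\Lambda(\mathcal{Q})$ is $*$-reciprocal free. (3) $p=m=n=q$, and - if $\star=\top$: $\Lambda(\mathcal{Q})\setminus\{1,-1\}$ is reciprocal free and $m_1(\mathcal{Q})=m_{-1}(\mathcal{Q})\leq 1$; - if $\star=*$: $\Lambda(\mathcal{Q})$ is $*$-reciprocal free.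
   Context: $M^\top$ is the transpose and $M^*$ the conjugate transpose of $M$; $M^\star$ denotes either of them according to the choice of $\star$. A matrix pencil $\mathcal{P}(\lambda)=\lambda M+N$ is singular if it is rectangular (non-square) or if $q(\lambda):=\det\mathcal{P}(\lambda)$ is identically zero; otherwise it is regular. For a regular pencil of size $k\times k$, the spectrum $\Lambda(\mathcal{P})\subseteq\mathbb{C}\cup\{\infty\}$ is the set of roots of $q(\lambda)$, together with $\infty$ if $\deg q<k$. $m_\lambda(\mathcal{P})$ denotes the algebraic multiplicity of $\lambda$ as an eigenvalue of $\mathcal{P}$ (equal to $0$ if $\lambda$ is not an eigenvalue); $m_\infty(\mathcal{P})$ is the multiplicity of $0$ as an eigenvalue of the reversal pencil $\lambda N+M$, i.e. $k-\deg q$. Core eigenvalues: when $p=m$ and $q=n$, $\mathcal{Q}$ has the infinite eigenvalue with multiplicity at least $|m-n|$, and one sets $\widehat\Lambda(\mathcal{Q}):=\Lambda(\mathcal{Q})$ if $m_\infty(\mathcal{Q})>|m-n|$ and $\widehat\Lambda(\mathcal{Q}):=\Lambda(\mathcal{Q})\setminus\{\infty\}$ if $m_\infty(\mathcal{Q})=|m-n|$. When $p=n$ and $q=m$, $\mathcal{Q}$ has the zero eigenvalue with multiplicity at least $|m-n|$, and one sets $\widetilde\Lambda(\mathcal{Q}):=\Lambda(\mathcal{Q})$ if $m_0(\mathcal{Q})>|m-n|$ and $\widetilde\Lambda(\mathcal{Q}):=\Lambda(\mathcal{Q})\setminus\{0\}$ if $m_0(\mathcal{Q})=|m-n|$. A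 set $\mathcal{S}\subseteq\mathbb{C}\cup\{\infty\}$ is reciprocal free if $\lambda\neq\mu^{-1}$ for all $\lambda,\mu\in\mathcal{S}$ (including $\lambda=\mu$), and $*$-reciprocal free if $\lambda\neq(\overline{\mu})^{-1}$ for all $\lambda,\mu\in\mathcal{S}$ (including $\lambda=\mu$), with the conventions $0^{-1}=(\overline{0})^{-1}=\infty$ and $\infty^{-1}=(\overline{\infty})^{-1}=0$. *)

(* Defs.v *)
From mathcomp Require Import all_boot all_order all_algebra.
From mathcomp Require Import sesquilinear spectral.
From mathcomp Require Import complex.
From mathcomp Require Import classical_sets reals.

Set Implicit Arguments.
Unset Strict Implicit.
Unset Printing Implicit Defensive.

Import Order.TTheory GRing.Theory Num.Theory.

Local Open Scope classical_set_scope.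
Local Open Scope ring_scope.
Local Open Scope sesquilinear_scope.

Variant star_kind := Transpose | ConjTranspose.

Definition star (F : numClosedFieldType) (s : star_kind) (m n : nat)
    (M : 'M[F]_(m, n)) : 'M[F]_(n, m) :=
  match s with
  | Transpose => M^T
  | ConjTranspose => M ^t*
  end.

Definition invertible_mx (F : fieldType) (m n : nat) (M : 'M[F]_(m, n)) : Prop :=
  exists e : m = n, castmx (e, erefl n) M \in unitmx.

(* [Pencil M N] stands for lambda M + N. *)
Record pencil (F : fieldType) (k l : nat) := Pencil {
  pencil_lead : 'M[F]_(k, l);
  pencil_const : 'M[F]_(k, l) }.

Definition pencil_mx (F : fieldType) (k l : nat) (P : pencil F k l) :
    'M[{poly F}]_(k, l) :=
  'X *: map_mx polyC (pencil_lead P) + map_mx polyC (pencil_const P).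

Definition reversal (F : fieldType) (k l : nat) (P : pencil F k l) :
    pencil F k l :=
  Pencil (pencil_const P) (pencil_lead P).

(* Junk value 0 for a rectangular pencil. *)
Definition pencil_det (F : fieldType) (k l : nat) (P : pencil F k l) :
    {poly F} :=
  match k =P l with
  | ReflectT e => \det (castmx (e, erefl l) (pencil_mx P))
  | ReflectF _ => 0
  end.

Definition singular_pencil (F : fieldType) (k l : nat) (P : pencil F k l) : Prop :=
  k <> l \/ pencil_det P = 0.

Definition regular_pencil (F : fieldType) (k l : nat) (P : pencil F k l) : Prop :=
  ~ singular_pencil P.

(* Points of F U {oo} are encoded as [option F], with [None] for oo. *)
Notation infty := None (only parsing).

(* [spectrum] and [multiplicity] are only meaningful for regular pencils. Since
   [size q] is deg q + 1 for q != 0, [size q <= k] means deg q < k. *)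
Definition spectrum (F : fieldType) (k l : nat) (P : pencil F k l) :
    set (option F) :=
  [set z | match z with
           | Some a => root (pencil_det P) a
           | None => (size (pencil_det P) <= k)%N
           end].

Definition multiplicity (F : fieldType) (k l : nat) (z : option F)
    (P : pencil F k l) : nat :=
  match z with
  | Some a => mup a (pencil_det P)
  | None => mup 0 (pencil_det (reversal P))
  end.

(* The core eigenvalues, with d = |m - n| and z = oo for \widehat\Lambda, z = 0
   for \widetilde\Lambda. The block sizes force [d <= multiplicity z P] there,
   so the [else] branch is the case of equality. *)
Definition core_spectrum (F : fieldType) (k l : nat) (z : option F) (d : nat)
    (P : pencil F k l) : set (option F) :=
  if (d < multiplicity z P)%N then spectrum P else spectrum P `\ z.

Definition ext_inv (F : fieldType) (z : option F) : option F :=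
  match z with
  | Some a => if a == 0 then infty else Some a^-1
  | None => Some 0
  end.

Definition ext_conj (F : numClosedFieldType) (z : option F) : option F :=
  omap (fun a : F => a^*) z.

Definition reciprocal_free (F : fieldType) (S : set (option F)) : Prop :=
  forall x y : option F, S x -> S y -> x <> ext_inv y.

Definition conj_reciprocal_free (F : numClosedFieldType)
    (S : set (option F)) : Prop :=
  forall x y : option F, S x -> S y -> x <> ext_inv (ext_conj y).

(* The spectral requirement shared by the three situations, S being the set of
   (core) eigenvalues of P that is relevant in each of them. *)
Definition spectral_condition (F : numClosedFieldType) (s : star_kind)
    (k l : nat) (P : pencil F k l) (S : set (option F)) : Prop :=
  match s with
  | Transpose =>
      reciprocal_free (S `\` [set Some (1 : F); Some (-1 : F)]) /\
      multiplicity (Some (1 : F)) P = multiplicity (Some (-1 : F)) P /\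
      (multiplicity (Some (-1 : F)%R) P <= 1)%N
  | ConjTranspose => conj_reciprocal_free S
  end.

(* [ lambda D^*  B^*      ]
   [ A           lambda C ] *)
Definition sylvester_pencil (F : numClosedFieldType) (s : star_kind)
    (m n p q : nat) (A : 'M[F]_(p, m)) (B : 'M[F]_(n, q)) (C : 'M[F]_(p, n))
    (D : 'M[F]_(m, q)) : pencil F (q + p) (m + n) :=
  Pencil (block_mx (star s D) 0 0 C) (block_mx 0 (star s B) A 0).

(* Main.v *)
Require Import Defs.
From HB Require Import structures.
From mathcomp Require Import all_boot all_order all_algebra.
From mathcomp Require Import sesquilinear spectral.
From mathcomp Require Import complex.
From mathcomp Require Import classical_sets reals.
From mathcomp Require Import ring zify.

Set Implicit Arguments.
Unset Strict Implicit.
Unset Printing Implicit Defensive.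

Import Order.TTheory GRing.Theory Num.Theory.

Local Open Scope classical_set_scope.
Local Open Scope ring_scope.

(**
  Bijectivity is equality of dimensions together with injectivity ([sylv_bijP]).
  It forces the sizes and the invertibility of one of the coefficients
  ([bijective_sizes]): if, say, [A] has a kernel and [B] has a right kernel,
  rank one unknowns and right-hand sides evaluated on these kernels see only
  the term [C *m star X *m D], and [C] must be invertible.

  For square coefficients, the four matrices can be made triangular together by
  deflation, as in the periodic Schur form: there are nonzero vectors [x] and
  [y] such that [A *m x] and [C *m y] are parallel, and so are [star D *m x] and
  [star B *m y]. With diagonal entries [a_i], [b_i], [c_i], [d_i], set
  [alpha_i = a_i * sconj b_i] and [gamma_i = c_i * sconj d_i]. Then the
  determinant of the pencil is, up to a constant, the product of the
  [alpha_i - gamma_i 'X^2], while the triangular equation splits into scalar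
  equations in [x_ii] and into 2 x 2 systems in [x_ij] and [star x_ji], of
  determinants [sconj alpha_i * alpha_j - sconj gamma_i * gamma_j] up to
  applying [sconj]. The list of the pairs
  [(alpha_i, gamma_i)] therefore decides injectivity and carries the spectrum
  ([square_data]). The induction adds one row and one column at a time; the
  systems in which the new row and column occur have as matrix the star of the
  trailing pencil matrix at suitable scalars, which is why the determinant is
  computed with one scalar for each block.

  If [m < n] and [A] is invertible, the columns of [X] that [C] annihilates
  after a change of basis are determined separately, and a square equation of
  size [m] remains; its pencil has the same determinant up to a constant, and
  the factor ['X^(n - m)] that appears in the reversal accounts for the infinite
  eigenvalues excluded from the core spectrum ([wide_pencil_data]). The other
  rectangular situations follow by starring the equation or by taking [star X]
  as the unknown ([pencil_data_star], [pencil_data_swap]).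

  It remains to compare the conditions on the list with the spectral ones. The
  eigenvalues are the square roots of [alpha_i / gamma_i], so that a vanishing
  2 x 2 determinant is a pair of reciprocal eigenvalues ([cross_okPn]). For the
  transpose, the scalar equation is singular when [alpha_i = - gamma_i], in
  which case ['i] and [- 'i] are reciprocal eigenvalues, but not when
  [alpha_i = gamma_i], which explains the role of 1 and -1
  ([spectral_condition_data]).
*)

(** * The star operation as transposition twisted by an involution *)

(** Both kinds of star are transposition followed by an involutive ring
    automorphism applied entrywise. The argument is uniform in that automorphism,
    apart from the count of dimensions, the 1 x 1 equation and the final
    comparison with the spectrum. *)
Definition sconj (F : numClosedFieldType) (s : star_kind) (x : F) : F :=
  if s is ConjTranspose then x^* else x.

Section Sconj.
Variables (F : numClosedFieldType) (s : star_kind).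

Fact sconj_is_zmod_morphism : zmod_morphism (@sconj F s).
Proof. by case: s => x y; rewrite /sconj ?rmorphB. Qed.

Fact sconj_is_monoid_morphism : monoid_morphism (@sconj F s).
Proof. by case: s; split=> [|x y]; rewrite /sconj ?rmorph1 ?rmorphM. Qed.

HB.instance Definition _ :=
  GRing.isZmodMorphism.Build F F (@sconj F s) sconj_is_zmod_morphism.
HB.instance Definition _ :=
  GRing.isMonoidMorphism.Build F F (@sconj F s) sconj_is_monoid_morphism.

Lemma sconjK : involutive (@sconj F s).
Proof. by case: s => x //=; rewrite conjCK. Qed.

Lemma starE m n (M : 'M[F]_(m, n)) : star s M = map_mx (sconj s) M^T.
Proof. by case: s => //=; apply/matrixP=> i j; rewrite !mxE. Qed.

Lemma starK m n (M : 'M[F]_(m, n)) : star s (star s M) = M.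
Proof. by rewrite !starE; apply/matrixP=> i j; rewrite !mxE sconjK. Qed.

Lemma star0 m n : star s (0 : 'M[F]_(m, n)) = 0.
Proof. by rewrite starE trmx0 map_mx0. Qed.

Lemma starD m n (M N : 'M[F]_(m, n)) : star s (M + N) = star s M + star s N.
Proof. by rewrite !starE linearD map_mxD. Qed.

Lemma starN m n (M : 'M[F]_(m, n)) : star s (- M) = - star s M.
Proof. by rewrite !starE linearN map_mxN. Qed.

Lemma starZ m n a (M : 'M[F]_(m, n)) : star s (a *: M) = sconj s a *: star s M.
Proof. by rewrite !starE linearZ map_mxZ. Qed.

Lemma starM m n p (M : 'M[F]_(m, n)) (N : 'M[F]_(n, p)) :
  star s (M *m N) = star s N *m star s M.
Proof. by rewrite !starE trmx_mul map_mxM. Qed.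

Lemma star_eq0 m n (M : 'M[F]_(m, n)) : (star s M == 0) = (M == 0).
Proof.
apply/eqP/eqP=> [M0|->]; last by rewrite star0.
by rewrite -[M]starK M0 star0.
Qed.

Lemma star_block m1 m2 n1 n2 (M : 'M[F]_(m1, n1)) N P (Q : 'M[F]_(m2, n2)) :
  star s (block_mx M N P Q) = block_mx (star s M) (star s P) (star s N) (star s Q).
Proof. by rewrite !starE tr_block_mx map_block_mx. Qed.

Lemma star_row m n1 n2 (M : 'M[F]_(m, n1)) (N : 'M[F]_(m, n2)) :
  star s (row_mx M N) = col_mx (star s M) (star s N).
Proof. by rewrite !starE tr_row_mx map_col_mx. Qed.

Lemma det_star n (M : 'M[F]_n) : \det (star s M) = sconj s (\det M).
Proof. by rewrite starE det_map_mx det_tr. Qed.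

Lemma star_unit n (M : 'M[F]_n) : (star s M \in unitmx) = (M \in unitmx).
Proof. by rewrite starE map_unitmx unitmx_tr. Qed.

Lemma star_scalar a : star s (a%:M : 'M[F]_1) = (sconj s a)%:M.
Proof. by rewrite starE tr_scalar_mx map_scalar_mx. Qed.

End Sconj.

(** * Determinants of matrices whose squareness is propositional *)

Section Gdet.
Variable K : comNzRingType.

(** The junk convention is that of [pencil_det], which is [gdet] of the matrix
    of the pencil. Block identities between matrices with sizes such as
    [q + p] and [m + n] then yield determinant identities without casts. *)
Definition gdet (k l : nat) (M : 'M[K]_(k, l)) : K :=
  match k =P l with
  | ReflectT e => \det (castmx (e, erefl l) M)
  | ReflectF _ => 0
  end.

Lemma gdetE n (M : 'M[K]_n) : gdet M = \det M.
Proof. by rewrite /gdet; case: eqP => // e; rewrite castmx_id. Qed.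

Lemma gdet_cast k l k' l' (e : (k = k') * (l = l')) (M : 'M[K]_(k, l)) :
  gdet (castmx e M) = gdet M.
Proof. by case: e => ek el; case: _ / ek; case: _ / el; rewrite castmx_id. Qed.

Lemma gdetM k l r (M : 'M[K]_(k, l)) (N : 'M[K]_(l, r)) :
  k = l -> gdet (M *m N) = gdet M * gdet N.
Proof.
move=> e; subst l; have [e|ne] := k =P r.
  by subst r; rewrite !gdetE det_mulmx.
by rewrite {1 3}/gdet; case: eqP => // _; rewrite mulr0.
Qed.

Lemma gdet_mul2 k l (L : 'M[K]_k) (M : 'M[K]_(k, l)) (N : 'M[K]_l) :
  gdet (L *m M *m N) = \det L * gdet M * \det N.
Proof.
have [e|ne] := k =P l.
  by subst l; rewrite !gdetE !det_mulmx.
by rewrite {1 2}/gdet; case: eqP => // _; rewrite mulr0 mul0r.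
Qed.

End Gdet.

Lemma gdet_map (K L : comNzRingType) (f : {rmorphism K -> L}) k l
    (M : 'M[K]_(k, l)) : gdet (map_mx f M) = f (gdet M).
Proof.
rewrite /gdet; case: eqP => [e|_]; last by rewrite rmorph0.
by rewrite -map_castmx det_map_mx.
Qed.

(** Multiplying by this permutation matrix exchanges the two block rows, or the
    two block columns. The sizes [a + b] and [b + a] are not convertible, whence
    [gdet] below. *)
Definition swap_mx (K : nzRingType) a b : 'M[K]_(a + b, b + a) :=
  block_mx 0 1%:M 1%:M 0.

Lemma map_swap_mx (K L : nzRingType) (f : {rmorphism K -> L}) a b :
  map_mx f (swap_mx K a b) = swap_mx L a b.
Proof. by rewrite map_block_mx !map_mx1 !map_mx0. Qed.

Lemma swap_mxK (K : nzRingType) a b : swap_mx K a b *m swap_mx K b a = 1%:M.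
Proof.
by rewrite mulmx_block !mul0mx !mul1mx !add0r !addr0 -scalar_mx_block.
Qed.

Lemma gdet_swap_neq0 (F : fieldType) a b : gdet (swap_mx F a b) != 0.
Proof.
have: gdet (swap_mx F a b) * gdet (swap_mx F b a) = 1.
  by rewrite -gdetM ?(addnC a) // swap_mxK gdetE det1.
by apply: contra_eq_neq => ->; rewrite mul0r eq_sym oner_eq0.
Qed.

Lemma swap_mulmx (K : nzRingType) a b c d (M : 'M[K]_(b, c)) N P (Q : 'M[K]_(a, d)) :
  swap_mx K a b *m block_mx M N P Q = block_mx P Q M N.
Proof. by rewrite mulmx_block !mul0mx !mul1mx !add0r !addr0. Qed.

Lemma mulmx_swap (K : nzRingType) a b c d (M : 'M[K]_(a, c)) N P (Q : 'M[K]_(b, d)) :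
  block_mx M N P Q *m swap_mx K c d = block_mx N M Q P.
Proof. by rewrite mulmx_block !mulmx0 !mulmx1 !add0r !addr0. Qed.
(** * Bijectivity, sizes and injectivity *)

Section Operator.
Variables (F : numClosedFieldType) (s : star_kind).

Definition sylv m n p q (A : 'M[F]_(p, m)) (B : 'M[F]_(n, q))
    (C : 'M[F]_(p, n)) (D : 'M[F]_(m, q)) (X : 'M[F]_(m, n)) : 'M[F]_(p, q) :=
  A *m X *m B + C *m star s X *m D.

Definition sylv_inj m n p q (A : 'M[F]_(p, m)) (B : 'M[F]_(n, q))
    (C : 'M[F]_(p, n)) (D : 'M[F]_(m, q)) : Prop :=
  forall X, sylv A B C D X = 0 -> X = 0.

Definition sylv_surj m n p q (A : 'M[F]_(p, m)) (B : 'M[F]_(n, q))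
    (C : 'M[F]_(p, n)) (D : 'M[F]_(m, q)) : Prop :=
  forall E, exists X, sylv A B C D X = E.

Lemma linear_dim (V W : vectType F) (f : {linear V -> W}) :
  (forall x, f x = 0 -> x = 0) ->
  (forall y, exists x, f x = y) <-> dim V = dim W.
Proof.
move=> f_inj; have kf : lker (linfun f) == 0%VS.
  by apply/lker0P => x y; rewrite !lfunE => fxy; apply/subr0_eq/f_inj;
    rewrite linearB fxy subrr.
have dim_im : \dim (limg (linfun f)) = dim V.
  by rewrite limg_dim_eq ?dimvf // (eqP kf) capv0.
split=> [f_surj|eVW y].
  rewrite -dim_im -[dim W]dimvf; congr (\dim _); apply/eqP.
  rewrite eqEsubv subvf /=; apply/subvP => y _; have [x <-] := f_surj y.
  by rewrite -[f x]lfunE memv_img ?memvf.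
have: y \in limg (linfun f).
  suff -> : limg (linfun f) = fullv by rewrite memvf.
  by apply/eqP; rewrite eqEdim subvf dim_im eVW dimvf leqnn.
by case/memv_imgP => x _ ->; exists x; rewrite lfunE.
Qed.

Variables (m n p q : nat).
Variables (A : 'M[F]_(p, m)) (B : 'M[F]_(n, q)) (C : 'M[F]_(p, n)) (D : 'M[F]_(m, q)).

Lemma sylvD X Y : sylv A B C D (X + Y) = sylv A B C D X + sylv A B C D Y.
Proof. by rewrite /sylv starD !(mulmxDr, mulmxDl) addrACA. Qed.

Lemma sylv0 : sylv A B C D 0 = 0.
Proof. by rewrite /sylv star0 !(mulmx0, mul0mx) addr0. Qed.

Lemma sylvN X : sylv A B C D (- X) = - sylv A B C D X.
Proof. by apply/eqP; rewrite -addr_eq0 -sylvD addNr sylv0. Qed.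

(** The conjugate equation is only real linear. Replacing [star X] by an
    independent unknown [Y], and adding the starred equation, gives a complex
    linear map: the complexification of the original one. *)
Definition sylv_pair (Z : 'M[F]_(m, n) * 'M[F]_(n, m)) :
    'M[F]_(p, q) * 'M[F]_(q, p) :=
  (A *m Z.1 *m B + C *m Z.2 *m D,
   star s B *m Z.2 *m star s A + star s D *m Z.1 *m star s C).

Fact sylv_pair_is_linear : linear sylv_pair.
Proof.
move=> a [X1 X2] [Y1 Y2]; rewrite /sylv_pair /=; congr (_, _) => /=;
by rewrite !(mulmxDr, mulmxDl) -!(scalemxAr, scalemxAl) scalerDr addrACA.
Qed.

HB.instance Definition _ :=
  GRing.isLinear.Build F _ _ _ sylv_pair sylv_pair_is_linear.

End Operator.

Section Dimension.
Variables (F : numClosedFieldType) (m n p q : nat).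
Variables (A : 'M[F]_(p, m)) (B : 'M[F]_(n, q)) (C : 'M[F]_(p, n)) (D : 'M[F]_(m, q)).

Lemma sylvZi (X : 'M[F]_(m, n)) :
  sylv ConjTranspose A B C D ('i *: X) =
  'i *: (A *m X *m B - C *m star ConjTranspose X *m D).
Proof.
rewrite /sylv starZ /sconj conjCi scaleNr.
by rewrite !(mulmxN, mulNmx) -!(scalemxAl, scalemxAr) -scalerBr.
Qed.

Let S := sylv ConjTranspose A B C D.
Let L := sylv_pair ConjTranspose A B C D.

Fact two_neq0 : 2 != 0 :> F. Proof. by rewrite pnatr_eq0. Qed.

(** A pair [(X, Y)] in the kernel yields the two kernel elements [X + star Y]
    and ['i *: (X - star Y)] of the original operator. *)
Lemma sylv_pair_inj :
  (forall Z, L Z = 0 -> Z = 0) <-> sylv_inj ConjTranspose A B C D.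
Proof.
split=> [L_inj X SX0|S_inj [X Y] [eL1 eL2]].
  have [] : (X, star ConjTranspose X) = 0 :> _ * _.
    2: by [].
  apply: L_inj; congr (_, _) => //=.
  by rewrite -[RHS](star0 _ ConjTranspose) -SX0 starD !starM starK !mulmxA addrC.
have {eL2} eL2 : A *m star ConjTranspose Y *m B + C *m star ConjTranspose X *m D = 0.
  move/(congr1 (@star F ConjTranspose _ _)): eL2.
  by rewrite star0 starD !starM !starK !mulmxA.
have e1 : X + star ConjTranspose Y = 0.
  apply: S_inj; rewrite /sylv starD starK !(mulmxDr, mulmxDl).
  by rewrite [X in _ + X]addrC addrACA eL1 eL2 addr0.
have e2 : 'i *: (X - star ConjTranspose Y) = 0.
  apply: S_inj; rewrite sylvZi starD starN starK !(mulmxDr, mulmxDl, mulmxN, mulNmx).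
  by rewrite opprB addrACA eL1 add0r -opprD eL2 oppr0 scaler0.
move/eqP: e2; rewrite scaler_eq0 (negPf (neq0Ci F)) orFb subr_eq0 => /eqP eX.
move: e1; rewrite -eX -mulr2n -scaler_nat => /eqP.
rewrite scaler_eq0 (negPf two_neq0) /= => /eqP X0; rewrite X0 in eX *.
by congr (_, _); rewrite -[LHS](starK ConjTranspose) -eX star0.
Qed.

(** Every pair [(E, G)] is a combination [U + 'i V] of pairs of the form
    [(E1, star E1)], and those are hit by pairs [(X1, star X1)]. *)
Lemma sylv_pair_surj :
  (forall W, exists Z, L Z = W) <-> sylv_surj ConjTranspose A B C D.
Proof.
split=> [L_surj E|S_surj [E G]].
  have [[X Y] [eL1 eL2]] := L_surj (E, star ConjTranspose E).
  exists (2^-1 *: (X + star ConjTranspose Y)).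
  move/(congr1 (@star F ConjTranspose _ _)): eL2.
  rewrite starD !starM !starK !mulmxA => eL2.
  rewrite /sylv starZ starD starK ?fmorphV ?rmorph_nat.
  rewrite -!(scalemxAl, scalemxAr) -scalerDr !(mulmxDr, mulmxDl).
  rewrite [X in _ + X]addrC addrACA eL1 eL2.
  by rewrite -mulr2n -scaler_nat scalerA mulVf ?two_neq0 // scale1r.
(* E1 = (E + star G) / 2 and E2 = (E - star G) / (2 i). *)
pose G' := star ConjTranspose G.
have [X1 eX1] := S_surj (2^-1 *: (E + G')).
have [X2 eX2] := S_surj ((2^-1 * - 'i) *: (E - G')).
pose st k l := @star F ConjTranspose k l.
exists (X1 + 'i *: X2, st _ _ X1 + 'i *: st _ _ X2).
rewrite /L /sylv_pair /=; congr (_, _).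
  rewrite !(mulmxDr, mulmxDl) -!(scalemxAl, scalemxAr) addrACA -scalerDr.
  rewrite -[A *m X1 *m B + _]/(S X1) -[A *m X2 *m B + _]/(S X2) /S eX1 eX2.
  rewrite scalerA mulrCA mulrN -expr2 sqrCi opprK mulr1 -scalerDr.
  by rewrite addrACA subrr addr0 -mulr2n -scaler_nat scalerA mulVf ?two_neq0 ?scale1r.
rewrite !(mulmxDr, mulmxDl) -!(scalemxAl, scalemxAr) addrACA -scalerDr.
have eqS X : st _ _ B *m st _ _ X *m st _ _ A + st _ _ D *m X *m st _ _ C = st _ _ (S X).
  by rewrite /st starD !starM starK !mulmxA.
have c2 : sconj ConjTranspose (2^-1 : F) = 2^-1 by rewrite fmorphV rmorph_nat.
have c2i : sconj ConjTranspose (2^-1 * - 'i : F) = 2^-1 * 'i.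
  by rewrite /sconj rmorphM rmorphN fmorphV rmorph_nat [X in - X]conjCi opprK.
rewrite !eqS /S eX1 eX2 /st !starZ !starD /G' starN !starK c2 c2i.
rewrite scalerA mulrCA -expr2 sqrCi mulrN1 scaleNr -scalerBr.
rewrite opprB addrC addrA subrK.
by rewrite -mulr2n -scaler_nat scalerA mulVf ?two_neq0 ?scale1r.
Qed.
End Dimension.

(** The operator is linear for the transpose, and its complexification is linear
    for the conjugate transpose, so that in both cases bijectivity amounts to
    injectivity together with equality of dimensions. *)
Lemma sylv_bijP (F : numClosedFieldType) s m n p q
    (A : 'M[F]_(p, m)) (B : 'M[F]_(n, q)) (C : 'M[F]_(p, n)) (D : 'M[F]_(m, q)) :
  (forall E, exists! X, sylv s A B C D X = E) <->
  (m * n = p * q)%N /\ sylv_inj s A B C D.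
Proof.
have inj_dim : sylv_inj s A B C D -> sylv_surj s A B C D <-> (m * n = p * q)%N.
  case: s => S_inj.
    have f_lin : linear (sylv Transpose A B C D).
      move=> a X Y; rewrite sylvD; congr (_ + _).
      by rewrite /sylv starZ -!(scalemxAl, scalemxAr) -scalerDr.
    pose f : {linear 'M[F]_(m, n) -> 'M[F]_(p, q)} :=
      HB.pack (sylv Transpose A B C D)
        (GRing.isLinear.Build F _ _ _ (sylv Transpose A B C D) f_lin).
    have := linear_dim (f := f) S_inj.
    by rewrite !dim_matrix.
  have /linear_dim := (sylv_pair_inj A B C D).2 S_inj.
  rewrite sylv_pair_surj => ->.
  rewrite -[dim ('M[F]_(m, n) * 'M[F]_(n, m))%type]/(dim 'M[F]_(m, n) + dim 'M[F]_(n, m))%N.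
  rewrite -[dim ('M[F]_(p, q) * 'M[F]_(q, p))%type]/(dim 'M[F]_(p, q) + dim 'M[F]_(q, p))%N.
  rewrite !dim_matrix; lia.
split=> [S_bij|[e S_inj] E].
  have S_inj : sylv_inj s A B C D.
    have [X [_ X_uniq]] := S_bij 0 => Y SY.
    by rewrite -(X_uniq Y SY) (X_uniq 0) ?sylv0.
  split=> //; apply/(inj_dim S_inj) => E.
  by have [X [SX _]] := S_bij E; exists X.
have [X SX] := (inj_dim S_inj).2 e E; exists X; split=> // Y SY.
by apply/subr0_eq/S_inj; rewrite sylvD sylvN SX SY subrr.
Qed.
(** * Sizes forced by bijectivity *)

Section Kernels.
Variable F : fieldType.

Lemma row_kernel m n (M : 'M[F]_(m, n)) : (n < m)%N ->
  exists2 v : 'rV[F]_m, v != 0 & v *m M = 0.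
Proof.
move=> lt_nm; have: ~~ row_free M.
  by rewrite -row_leq_rank -ltnNge (leq_ltn_trans (rank_leq_col M)).
rewrite -kermx_eq0 => /rowV0Pn[v /sub_kermxP vM v0].
by exists v.
Qed.

Lemma col_kernel m n (M : 'M[F]_(m, n)) : (m < n)%N ->
  exists2 v : 'cV[F]_n, v != 0 & M *m v = 0.
Proof.
move=> /(row_kernel M^T)[v v0 vM]; exists v^T.
  by apply: contra_neq v0 => v0; rewrite -[v]trmxK v0 trmx0.
by rewrite -[M]trmxK -trmx_mul vM trmx0.
Qed.

Lemma row_section n (v : 'rV[F]_n) : v != 0 -> exists w : 'cV_n, v *m w = 1%:M.
Proof.
move=> v0; apply/row_freeP.
by rewrite -row_leq_rank lt0n mxrank_eq0.
Qed.

Lemma col_retraction n (v : 'cV[F]_n) : v != 0 -> exists w : 'rV_n, w *m v = 1%:M.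
Proof.
move=> v0; apply/row_fullP.
by rewrite -col_leq_rank lt0n mxrank_eq0.
Qed.

Lemma invertible_rows m n (M : 'M[F]_(m, n)) :
  (forall v : 'rV_m, v *m M = 0 -> v = 0) ->
  (forall w : 'rV_n, exists v : 'rV_m, v *m M = w) -> invertible_mx M.
Proof.
move=> /inj_row_free M_free M_surj.
have M_full : row_full M.
  rewrite -sub1mx; apply/row_subP => i; apply/submxP.
  by have [v <-] := M_surj (row i 1%:M); exists v.
have e : m = n by rewrite -(eqP M_free) (eqP M_full).
by exists e; subst n; rewrite castmx_id -row_free_unit.
Qed.

Lemma invertible_tr m n (M : 'M[F]_(m, n)) : invertible_mx M^T -> invertible_mx M.
Proof. by case=> e; subst m; rewrite castmx_id unitmx_tr => M1; exists erefl. Qed.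

Lemma invertible_cols m n (M : 'M[F]_(m, n)) :
  (forall v : 'cV_n, M *m v = 0 -> v = 0) ->
  (forall w : 'cV_m, exists v : 'cV_n, M *m v = w) -> invertible_mx M.
Proof.
move=> M_inj M_surj; apply/invertible_tr/invertible_rows => [v vM|w].
  apply: trmx_inj; rewrite trmx0; apply: M_inj.
  by rewrite -[LHS]trmxK trmx_mul trmxK vM trmx0.
by have [v Mv] := M_surj w^T; exists v^T; rewrite -trmx_mul Mv trmxK.
Qed.

End Kernels.

(** Rank one unknowns [u *m star y] with [A *m u = 0], and right-hand sides
    evaluated on the kernel of [B], see only one of the two terms of the
    equation. They show that the matrices of the other term cannot degenerate. *)
Section Sizes.
Variables (F : numClosedFieldType) (s : star_kind) (m n p q : nat).
Variables (A : 'M[F]_(p, m)) (B : 'M[F]_(n, q)) (C : 'M[F]_(p, n)) (D : 'M[F]_(m, q)).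

Lemma outer_eq0 a b (u : 'cV[F]_a) (v : 'rV[F]_b) : u *m v = 0 -> (u == 0) || (v == 0).
Proof.
case: eqP => //= /eqP /col_retraction[w wu] uv.
by rewrite -[v]mul1mx -wu -mulmxA uv mulmx0.
Qed.

Lemma invertible_C_of_wide_A : (p < m)%N -> (n < q)%N ->
  sylv_inj s A B C D -> sylv_surj s A B C D -> invertible_mx C.
Proof.
move=> lt_pm lt_nq S_inj S_surj.
have [u u0 Au] := col_kernel A lt_pm; have [z z0 Bz] := col_kernel B lt_nq.
apply: invertible_cols => [y Cy|w].
  have /outer_eq0 : u *m star s y = 0.
    by apply: S_inj; rewrite /sylv starM starK !mulmxA Au Cy !mul0mx addr0.
  by rewrite (negPf u0) star_eq0 => /eqP.
have [r rz] := col_retraction z0; have [X SX] := S_surj (w *m r).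
exists (star s X *m D *m z); rewrite -[RHS]mulmx1 -rz mulmxA -SX.
by rewrite mulmxDl -[A *m X *m B *m z]mulmxA Bz mulmx0 add0r !mulmxA.
Qed.

Lemma invertible_D_of_tall_A : (m < p)%N -> (q < n)%N ->
  sylv_inj s A B C D -> sylv_surj s A B C D -> invertible_mx D.
Proof.
move=> lt_mp lt_qn S_inj S_surj.
have [w w0 wB] := row_kernel B lt_qn; have [t t0 tA] := row_kernel A lt_mp.
apply: invertible_rows => [y yD|r].
  have /outer_eq0 : star s y *m w = 0.
    by apply: S_inj; rewrite /sylv starM starK -!mulmxA wB yD !mulmx0 addr0.
  by rewrite (negPf w0) orbF star_eq0 => /eqP.
have [e te] := row_section t0; have [X SX] := S_surj (e *m r).
exists (t *m C *m star s X); rewrite -[RHS]mul1mx -te -[RHS]mulmxA -SX.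
by rewrite mulmxDr !mulmxA tA !mul0mx add0r.
Qed.

Lemma bijective_sizes : (0 < m)%N -> (0 < n)%N -> (m * n = p * q)%N ->
  sylv_inj s A B C D -> sylv_surj s A B C D -> p <> m ->
  [/\ p = n, m = q &
    ((n < m)%N /\ invertible_mx C) \/ ((m < n)%N /\ invertible_mx D)].
Proof.
move=> m0 n0 e S_inj S_surj ne_pm; case: (ltngtP p m) => // [lt_pm|lt_mp].
  have lt_nq : (n < q)%N by nia.
  have C1 := invertible_C_of_wide_A lt_pm lt_nq S_inj S_surj.
  have [epn _] := C1; split=> //; first by nia.
  by left; split=> //; lia.
have lt_qn : (q < n)%N by nia.
have D1 := invertible_D_of_tall_A lt_mp lt_qn S_inj S_surj.
have [emq _] := D1; split=> //; first by nia.
by right; split=> //; lia.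
Qed.

End Sizes.

(** * The pencil matrix and its symmetries *)

Section Hmx.
Variables (F : numClosedFieldType) (sk : star_kind) (K : comNzRingType).
Variable (f : {rmorphism F -> K}).

(** The matrix of the pencil with an independent factor on each block. The
    pencil is the case [(s, t, u, v) = ('X, 1, 1, 'X)], its reversal the case
    [(1, 'X, 'X, 1)]. The induction on the size also needs a case with four
    distinct scalars, in which the kernel of the operator restricted to the
    off-diagonal blocks is governed by such a matrix. *)
Definition hpencil m n p q (s t u v : K) (A : 'M[F]_(p, m)) (B : 'M[F]_(n, q))
    (C : 'M[F]_(p, n)) (D : 'M[F]_(m, q)) : 'M[K]_(q + p, m + n) :=
  block_mx (s *: map_mx f (star sk D)) (t *: map_mx f (star sk B))
           (u *: map_mx f A) (v *: map_mx f C).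

Variables (m n p q : nat).
Variables (A : 'M[F]_(p, m)) (B : 'M[F]_(n, q)) (C : 'M[F]_(p, n)) (D : 'M[F]_(m, q)).

(** The substitution [X = V *m Y *m W], with left and right multiplication of the
    equation by [P] and [R], is a strict equivalence of the pencil. *)
Lemma hpencil_equiv m' n' p' q' (P : 'M[F]_(p', p)) (V : 'M[F]_(m, m'))
    (W : 'M[F]_(n', n)) (R : 'M[F]_(q, q')) s t u v :
  hpencil s t u v (P *m A *m V) (W *m B *m R) (P *m C *m star sk W) (star sk V *m D *m R) =
  map_mx f (block_mx (star sk R) 0 0 P) *m hpencil s t u v A B C D
    *m map_mx f (block_mx V 0 0 (star sk W)).
Proof.
rewrite /hpencil !map_block_mx !map_mx0 !mulmx_block !mul0mx !mulmx0 !addr0 !add0r.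
rewrite !starM !starK !map_mxM.
by rewrite -!(scalemxAl, scalemxAr) !mulmxA.
Qed.

Lemma gdet_hpencil_equiv (P : 'M[F]_p) (V : 'M[F]_m)
    (W : 'M[F]_n) (R : 'M[F]_q) s t u v :
  gdet (hpencil s t u v (P *m A *m V) (W *m B *m R) (P *m C *m star sk W)
         (star sk V *m D *m R)) =
  f (\det (star sk R) * \det P * (\det V * \det (star sk W))) *
    gdet (hpencil s t u v A B C D).
Proof.
rewrite hpencil_equiv gdet_mul2 !det_map_mx !det_ublock !rmorphM; ring.
Qed.

(** Taking [star X] as the unknown exchanges the pencil with its reversal, up to
    the order of the block columns. *)
Lemma hpencil_swap s t u v :
  hpencil s t u v C D A B = hpencil t s v u A B C D *m swap_mx K m n.
Proof. by rewrite mulmx_swap. Qed.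

(** Starring the whole equation only permutes the blocks of the pencil. *)
Lemma hpencil_star s t u v :
  hpencil s t u v (star sk B) (star sk A) (star sk D) (star sk C) =
  swap_mx K p q *m hpencil v u t s A B C D *m swap_mx K m n.
Proof. by rewrite /hpencil !starK swap_mulmx mulmx_swap. Qed.

End Hmx.

Lemma unit_mul_eq0 (F : fieldType) m n (P : 'M[F]_m) (M : 'M[F]_(m, n)) (R : 'M[F]_n) :
  P \in unitmx -> R \in unitmx -> P *m M *m R = 0 -> M = 0.
Proof.
move=> P1 R1 PMR; rewrite -[M](mulKmx P1) -[P *m M](mulmxK R1) PMR.
by rewrite mul0mx mulmx0.
Qed.

Section Symmetries.
Variables (F : numClosedFieldType) (s : star_kind) (m n p q : nat).
Variables (A : 'M[F]_(p, m)) (B : 'M[F]_(n, q)) (C : 'M[F]_(p, n)) (D : 'M[F]_(m, q)).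

Lemma sylv_swapE Y : sylv s C D A B Y = sylv s A B C D (star s Y).
Proof. by rewrite /sylv starK addrC. Qed.

Lemma sylv_starE Y :
  sylv s (star s B) (star s A) (star s D) (star s C) Y = star s (sylv s A B C D (star s Y)).
Proof. by rewrite /sylv starD !starM !starK !mulmxA. Qed.

Lemma sylv_surj_swap : sylv_surj s A B C D -> sylv_surj s C D A B.
Proof.
move=> S_surj E; have [X <-] := S_surj E; exists (star s X).
by rewrite sylv_swapE starK.
Qed.

Lemma sylv_inj_swap : sylv_inj s C D A B <-> sylv_inj s A B C D.
Proof.
split=> S_inj X SX; apply/eqP; rewrite -(star_eq0 s).
  by apply/eqP/S_inj; rewrite sylv_swapE starK.
by apply/eqP/S_inj; rewrite -sylv_swapE.
Qed.

Lemma sylv_inj_star :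
  sylv_inj s (star s B) (star s A) (star s D) (star s C) <-> sylv_inj s A B C D.
Proof.
split=> S_inj X.
  move=> SX; apply/eqP; rewrite -(star_eq0 s); apply/eqP/S_inj.
  by rewrite sylv_starE starK SX star0.
move/eqP; rewrite sylv_starE star_eq0 => /eqP /S_inj /eqP.
by rewrite star_eq0 => /eqP.
Qed.

Lemma sylv_equivE (P : 'M[F]_p) (V : 'M[F]_m) (W : 'M[F]_n) (R : 'M[F]_q) Y :
  sylv s (P *m A *m V) (W *m B *m R) (P *m C *m star s W) (star s V *m D *m R) Y =
  P *m sylv s A B C D (V *m Y *m W) *m R.
Proof. by rewrite /sylv !starM mulmxDr mulmxDl !mulmxA. Qed.

Lemma sylv_inj_equiv (P : 'M[F]_p) (V : 'M[F]_m) (W : 'M[F]_n) (R : 'M[F]_q) :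
  P \in unitmx -> V \in unitmx -> W \in unitmx -> R \in unitmx ->
  sylv_inj s (P *m A *m V) (W *m B *m R) (P *m C *m star s W) (star s V *m D *m R) <->
  sylv_inj s A B C D.
Proof.
move=> P1 V1 W1 R1; split=> S_inj X SX; last first.
  apply: (unit_mul_eq0 V1 W1); apply: S_inj; apply: (unit_mul_eq0 P1 R1).
  by rewrite -sylv_equivE.
have eX : V *m (invmx V *m X *m invmx W) *m W = X.
  by rewrite !mulmxA mulmxV // mul1mx mulmxKV.
by rewrite -eX (S_inj (invmx V *m X *m invmx W)) ?mulmx0 ?mul0mx // sylv_equivE eX SX
  mulmx0 mul0mx.
Qed.

End Symmetries.
(** * Square equations, by deflation *)

Section Shuffle.
Variables (K : comNzRingType) (i j : nat).

(** Rows [1, 3, 2, 4] of a matrix with four block rows of sizes [i, j, i, j]. *)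
Definition shuffle_mx : 'M[K]_((i + i) + (j + j), (i + j) + (i + j)) :=
  block_mx (block_mx 1%:M 0 0 0) (block_mx 0 0 1%:M 0)
           (block_mx 0 1%:M 0 0) (block_mx 0 0 0 1%:M).

Definition unshuffle_mx : 'M[K]_((i + j) + (i + j), (i + i) + (j + j)) :=
  block_mx (block_mx 1%:M 0 0 0) (block_mx 0 0 1%:M 0)
           (block_mx 0 1%:M 0 0) (block_mx 0 0 0 1%:M).

Lemma det_shuffle a b c d a' b' c' d' a2 b2 c2 d2 a3 b3 c3 d3 :
  \det (block_mx (block_mx a b c d) (block_mx a' b' c' d')
                 (block_mx a2 b2 c2 d2) (block_mx a3 b3 c3 d3) : 'M[K]_((i + j) + (i + j))) =
  \det (block_mx (block_mx a a' a2 a3) (block_mx b b' b2 b3)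
                 (block_mx c c' c2 c3) (block_mx d d' d2 d3)).
Proof.
set M := (X in \det X = _); set N := (X in _ = \det X).
pose simp := (mul0mx, mulmx0, mul1mx, mulmx1, addr0, add0r).
have eN : shuffle_mx *m M *m unshuffle_mx = N.
  by rewrite /shuffle_mx !mulmx_block !simp !add_block_mx !simp !mulmx_block !simp
    !add_block_mx !simp.
have e1 : unshuffle_mx *m shuffle_mx = 1%:M.
  rewrite mulmx_block !mulmx_block !simp !add_block_mx !simp.
  by rewrite -!scalar_mx_block block_mx0 -scalar_mx_block.
have eij : ((i + i) + (j + j) = (i + j) + (i + j))%N by rewrite addnACA.
have := congr1 (@gdet _ _ _) e1; rewrite gdetM // gdetE det1 => e2.
rewrite -[\det N]gdetE -eN !gdetM // mulrAC [gdet shuffle_mx * _]mulrC e2 mul1r.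
by rewrite gdetE.
Qed.

End Shuffle.

Section Square.
Variables (F : numClosedFieldType) (s : star_kind).
Implicit Types (a b c d : F) (x y : F * F) (l : seq (F * F)).

(** A pair [x] stands for a 1 x 1 equation with pencil determinant
    [x.1 - x.2 'X^2]. The condition says that the diagonal unknown of a
    triangular equation is determined. *)
Definition self_ok x : bool :=
  if s is Transpose then x.1 + x.2 != 0
  else sconj s x.1 * x.1 != sconj s x.2 * x.2.

(** The condition under which two off-diagonal unknowns in symmetric positions
    of a triangular equation, which are coupled by the star, are determined. *)
Definition cross_ok x y : bool :=
  sconj s x.1 * y.1 != sconj s x.2 * y.2.

Definition good l : bool := all self_ok l && pairwise cross_ok l.

(** For the conjugate star, [e z + g z^* = 0] has a nonzero solution exactly when
    [e] and [g] have the same modulus. *)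
Lemma sylv_inj_scalar a b c d :
  sylv_inj s (a%:M : 'M[F]_1) (b%:M : 'M_1) (c%:M : 'M_1) (d%:M : 'M_1) <->
  self_ok (a * sconj s b, c * sconj s d).
Proof.
have E X : sylv s (a%:M : 'M[F]_1) (b%:M : 'M_1) (c%:M : 'M_1) (d%:M : 'M_1) X =
    (a * b * X 0 0 + c * d * sconj s (X 0 0))%:M.
  rewrite /sylv [X in LHS]mx11_scalar star_scalar -!scalar_mxM -raddfD /=.
  by congr (_%:M); rewrite mulrAC [c * _ * d]mulrAC.
have -> : sylv_inj s (a%:M : 'M[F]_1) (b%:M : 'M_1) (c%:M : 'M_1) (d%:M : 'M_1) <->
    (forall z, a * b * z + c * d * sconj s z = 0 -> z = 0).
  split=> inj z.
    move=> ez; have /matrixP/(_ 0 0) : z%:M = 0 :> 'M_1.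
      by apply: inj; rewrite E mxE mulr1n ez raddf0.
    by rewrite !mxE.
  rewrite E => /matrixP/(_ 0 0); rewrite !mxE mulr1n => /inj z0.
  by rewrite [z]mx11_scalar z0 raddf0.
rewrite /self_ok /sconj; case: s => /=; rewrite /sconj.
  split=> [inj|e z].
    apply/eqP => e; have := inj 1; rewrite !mulr1 e => /(_ erefl) /eqP.
    by rewrite oner_eq0.
  by rewrite -mulrDl => /eqP; rewrite mulf_eq0 (negPf e) => /eqP.
have -> : ((a * b^*)^* * (a * b^*) != (c * d^*)^* * (c * d^*)) =
    ((a * b)^* * (a * b) != (c * d)^* * (c * d)).
  rewrite !rmorphM /= !conjCK.
  by congr (_ != _); ring.
move: (a * b) (c * d) => e g.
split=> [inj|ne z ez].
  apply/eqP => eg; have [e0|e0] := eqVneq e 0.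
    have g0 : g = 0.
      apply/eqP; rewrite -normr_eq0 -sqrf_eq0 normCK mulrC -eg e0 mulr0 eqxx //.
    have := inj 1; rewrite e0 g0 !mul0r addr0 => /(_ erefl) /eqP.
    by rewrite oner_eq0.
  (* When |e| = |g| every z t solves e z + g z^* = 0; if z 1 and z 'i both
     vanished, g / e would be 1 and -1 at once. *)
  pose z t : F := t - g / e * t^*.
  have z0 t : z t = 0.
    apply: inj; have ec : e^* != 0 by rewrite conjC_eq0.
    have -> : (z t)^* = t^* - g^* / e^* * t.
      by rewrite /z rmorphB !rmorphM fmorphV /= conjCK.
    transitivity ((e^* * e - g^* * g) * t / e^*).
      by rewrite /z; field; rewrite e0 ec.
    by rewrite eg subrr !mul0r.
  have /subr0_eq := z0 1; rewrite rmorph1 mulr1 => eg1.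
  have /subr0_eq := z0 'i; rewrite -eg1 mul1r conjCi => /eqP.
  rewrite -subr_eq0 opprK -mulr2n -mulr_natl mulf_eq0 (negPf (two_neq0 F)).
  by rewrite (negPf (neq0Ci F)).
have ez' : e^* * z^* + g^* * z = 0.
  by rewrite -[z in g^* * z]conjCK -!rmorphM -rmorphD ez rmorph0.
have : (e^* * e - g^* * g) * z = 0.
  transitivity (e^* * (e * z + g * z^*) - g * (e^* * z^* + g^* * z)); first by ring.
  by rewrite ez ez' !mulr0 subrr.
by move/eqP; rewrite mulf_eq0 subr_eq0 (negPf ne) => /eqP.
Qed.

Section Block.
Variables (N : nat) (a b c d : F).
Variables (A12 C12 : 'rV[F]_N) (B21 D21 : 'cV[F]_N) (A1 B1 C1 D1 : 'M[F]_N).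
Let A : 'M_(1 + N) := block_mx a%:M A12 0 A1.
Let B : 'M_(1 + N) := block_mx b%:M 0 B21 B1.
Let C : 'M_(1 + N) := block_mx c%:M C12 0 C1.
Let D : 'M_(1 + N) := block_mx d%:M 0 D21 D1.

(** The matrix acting on the off-diagonal blocks [star x21] and [x12]. It is the
    star of the trailing pencil matrix at scalars built from the leading
    entries, so that its invertibility is decided by the trailing spectrum. *)
Definition coupling_mx : 'M[F]_(N + N) :=
  star s (hpencil s idfun (sconj s c) (sconj s a) b d A1 B1 C1 D1).

Lemma mul_coupling (x : 'rV[F]_N) (y : 'cV[F]_N) :
  row_mx (star s y) x *m coupling_mx =
  row_mx (a *: (x *m B1) + c *: (star s y *m D1))
         (star s (b *: (A1 *m y) + d *: (C1 *m star s x))).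
Proof.
rewrite /coupling_mx /hpencil star_block !map_mx_id // !starZ !starK !sconjK.
rewrite mul_row_block starD !starZ !starM starK -!scalemxAr.
by rewrite [in LHS]addrC.
Qed.

Lemma sylv_blockE (x11 : 'M_1) (x12 : 'rV_N) (x21 : 'cV_N) (X22 : 'M_N) :
  sylv s A B C D (block_mx x11 x12 x21 X22) =
  block_mx
    (sylv s (a%:M : 'M_1) (b%:M : 'M_1) (c%:M : 'M_1) (d%:M : 'M_1) x11
      + (b *: (A12 *m x21) + (a *: x12 + A12 *m X22) *m B21
      + (d *: (C12 *m star s x12) + (c *: star s x21 + C12 *m star s X22) *m D21)))
    ((a *: (x12 *m B1) + c *: (star s x21 *m D1))
      + (A12 *m X22 *m B1 + C12 *m star s X22 *m D1))
    ((b *: (A1 *m x21) + d *: (C1 *m star s x12))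
      + (A1 *m X22 *m B21 + C1 *m star s X22 *m D21))
    (sylv s A1 B1 C1 D1 X22).
Proof.
rewrite /sylv star_block !mulmx_block add_block_mx.
rewrite !(mul0mx, mulmx0, add0r) !mul_scalar_mx !mul_mx_scalar.
congr block_mx.
- rewrite !mulmxDl !scalerDr -!scalemxAl; rewrite -!addrA; congr (_ + _).
  rewrite [X in _ + (_ + X)]addrCA [X in _ + X]addrCA.
  by rewrite addrCA.
- by rewrite !mulmxDl -!scalemxAl addrACA.
- by rewrite addrACA.
Qed.

End Block.
End Square.
Section SquareInduction.
Variables (F : numClosedFieldType) (s : star_kind).

(** The operator is block triangular for the order [X22], then [(x12, x21)],
    then [x11]. Its kernel is trivial if and only if the three diagonal blocks
    have a trivial kernel: a kernel element of one block extends to the others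
    because the blocks solved after it are surjective. *)
Lemma sylv_inj_block N (a b c d : F) (A12 C12 : 'rV[F]_N) (B21 D21 : 'cV[F]_N)
    (A1 B1 C1 D1 : 'M[F]_N) :
  sylv_inj s (block_mx a%:M A12 0 A1 : 'M_(1 + N)) (block_mx b%:M 0 B21 B1 : 'M_(1 + N))
             (block_mx c%:M C12 0 C1 : 'M_(1 + N)) (block_mx d%:M 0 D21 D1 : 'M_(1 + N))
  <-> [/\ self_ok s (a * sconj s b, c * sconj s d),
          coupling_mx s a b c d A1 B1 C1 D1 \in unitmx & sylv_inj s A1 B1 C1 D1].
Proof.
split=> [S_inj|[/sylv_inj_scalar S11_inj M1 S22_inj] X].
  have S11_inj : sylv_inj s (a%:M : 'M_1) (b%:M : 'M_1) (c%:M : 'M_1) (d%:M : 'M_1).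
    move=> x Sx; have /S_inj /eqP :
        sylv s (block_mx a%:M A12 0 A1 : 'M_(1 + N)) (block_mx b%:M 0 B21 B1 : 'M_(1 + N))
             (block_mx c%:M C12 0 C1 : 'M_(1 + N)) (block_mx d%:M 0 D21 D1 : 'M_(1 + N))
             (block_mx x 0 0 0) = 0.
      rewrite sylv_blockE Sx sylv0 !star0 !(mulmx0, mul0mx, scaler0, addr0).
      by rewrite block_mx0.
    by rewrite block_mx_eq0 => /and4P[/eqP].
  have S11_surj E : exists x, sylv s (a%:M : 'M_1) (b%:M : 'M_1) (c%:M : 'M_1) (d%:M : 'M_1) x = E.
    by have [x [Sx _]] := (sylv_bijP _ _ _ _ _).2 (conj erefl S11_inj) E; exists x.
  have M1 : coupling_mx s a b c d A1 B1 C1 D1 \in unitmx.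
    rewrite -row_free_unit; apply: inj_row_free => v.
    rewrite -[v]hsubmxK -[lsubmx v](starK s) mul_coupling -row_mx0.
    case/eq_row_mx => e1 /eqP; rewrite star_eq0 => /eqP e2.
    move: e1 e2; set y := star s (lsubmx v); set x := rsubmx v => e1 e2.
    have [x11 Sx11] := S11_surj (- (b *: (A12 *m y) + (a *: x + 0) *m B21
      + (d *: (C12 *m star s x) + (c *: star s y + 0) *m D21))).
    have /S_inj /eqP :
        sylv s (block_mx a%:M A12 0 A1 : 'M_(1 + N)) (block_mx b%:M 0 B21 B1 : 'M_(1 + N))
             (block_mx c%:M C12 0 C1 : 'M_(1 + N)) (block_mx d%:M 0 D21 D1 : 'M_(1 + N))
             (block_mx x11 x y 0) = 0.
      rewrite sylv_blockE Sx11 e1 e2 sylv0 !star0 !(mulmx0, mul0mx, addr0) addNr.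
      by rewrite block_mx0.
    rewrite block_mx_eq0 => /and4P[_ /eqP -> /eqP -> _].
    by rewrite star0 row_mx0.
  split=> //; first exact/sylv_inj_scalar.
  move=> X SX.
  set r12 := A12 *m X *m B1 + C12 *m star s X *m D1.
  set r21 := A1 *m X *m B21 + C1 *m star s X *m D21.
  pose v := - row_mx r12 (star s r21) *m invmx (coupling_mx s a b c d A1 B1 C1 D1).
  have := mul_coupling s a b c d A1 B1 C1 D1 (rsubmx v) (star s (lsubmx v)).
  rewrite starK hsubmxK mulmxKV // opp_row_mx => /eq_row_mx[/esym e1 /esym e2].
  move/(congr1 (@star F s _ _)): e2; rewrite starN !starK.
  move: e1; set y := star s (lsubmx v); rewrite -[lsubmx v](starK s) -/y.
  set x := rsubmx v => e1 e2.
  have [x11 Sx11] := S11_surj (- (b *: (A12 *m y) + (a *: x + A12 *m X) *m B21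
      + (d *: (C12 *m star s x) + (c *: star s y + C12 *m star s X) *m D21))).
  have /S_inj : sylv s (block_mx a%:M A12 0 A1 : 'M_(1 + N)) (block_mx b%:M 0 B21 B1 : 'M_(1 + N))
             (block_mx c%:M C12 0 C1 : 'M_(1 + N)) (block_mx d%:M 0 D21 D1 : 'M_(1 + N))
             (block_mx x11 x y X) = 0.
    by rewrite sylv_blockE SX Sx11 e1 e2 -/r12 -/r21 !addNr block_mx0.
  by move/eqP; rewrite block_mx_eq0 => /and4P[_ _ _ /eqP].
move/eqP; rewrite -[X]submxK sylv_blockE block_mx_eq0.
case/and4P => /eqP + /eqP + /eqP + /eqP.
move: (ulsubmx X) (ursubmx X) (dlsubmx X) (drsubmx X) => x11 x y X22.
move=> e11 e12 e21 /S22_inj X220; subst X22.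
move: e12 e21; rewrite star0 !(mulmx0, mul0mx, addr0) => e12 e21.
have : row_mx (star s y) x *m coupling_mx s a b c d A1 B1 C1 D1 = 0.
  by rewrite mul_coupling e12 e21 star0 row_mx0.
move/(congr1 (mulmx^~ (invmx (coupling_mx s a b c d A1 B1 C1 D1)))).
rewrite mulmxK // mul0mx -row_mx0 => /eq_row_mx[/eqP]; rewrite star_eq0 => /eqP y0 x0.
subst x y; move: e11; rewrite !star0 !(mulmx0, mul0mx, scaler0, addr0) => /S11_inj ->.
by rewrite block_mx0.
Qed.

Lemma det_mx2 (K : comNzRingType) (a b c d : K) :
  \det (block_mx a%:M b%:M c%:M d%:M : 'M_(1 + 1)) = a * d - b * c.
Proof.
rewrite (expand_det_row _ 0) !big_ord_recl big_ord0 addr0 /cofactor !det_mx11.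
do ?[rewrite !mxE /=; case: splitP => j; rewrite ?(ord1 j) //= => _; clear j].
by rewrite !mxE /= !mulr1n expr0 expr1 mul1r mulN1r mulrN.
Qed.

(** Grouping the first rows and columns of the two halves of the matrix makes it
    block triangular, with a leading 2 x 2 block. *)
Lemma det_hpencil_block (K : comNzRingType) (f : {rmorphism F -> K})
    N (a b c d : F) (A12 C12 : 'rV[F]_N) (B21 D21 : 'cV[F]_N)
    (A1 B1 C1 D1 : 'M[F]_N) u v w z :
  \det (hpencil s f u v w z
         (block_mx a%:M A12 0 A1 : 'M_(1 + N)) (block_mx b%:M 0 B21 B1 : 'M_(1 + N))
         (block_mx c%:M C12 0 C1 : 'M_(1 + N)) (block_mx d%:M 0 D21 D1 : 'M_(1 + N))) =
  f (-1) * (v * w * f (a * sconj s b) - u * z * f (c * sconj s d)) *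
    \det (hpencil s f u v w z A1 B1 C1 D1).
Proof.
rewrite /hpencil !star_block !map_block_mx !scale_block_mx !star0 !map_mx0 !scaler0.
rewrite det_shuffle -/(hpencil s f u v w z A1 B1 C1 D1) [X in block_mx _ _ X _]block_mx0.
rewrite det_ublock; congr (_ * _).
rewrite !star_scalar !map_scalar_mx !scale_scalar_mx det_mx2.
by rewrite rmorphN1 !rmorphM; ring.
Qed.

(** Both vectors lie on a common line, and the line is given by a nonzero
    spanning vector even when both vectors vanish. *)
Definition parallel N (v1 v2 : 'cV[F]_N) : Prop :=
  exists u a1 a2, [/\ u != 0, v1 = a1 *: u & v2 = a2 *: u].

Lemma parallelZ N (v : 'cV[F]_N.+1) k : parallel v (k *: v).
Proof.
have [->|v0] := eqVneq v 0; last by exists v, 1, k; rewrite scale1r.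
exists (const_mx 1), 0, 0; rewrite scaler0 scale0r; split=> //.
by apply/eqP => /matrixP/(_ 0 0)/eqP; rewrite !mxE oner_eq0.
Qed.

Lemma parallel_sym N (v1 v2 : 'cV[F]_N) : parallel v1 v2 -> parallel v2 v1.
Proof. by case=> u [a1 [a2 []]]; exists u, a2, a1. Qed.

Lemma parallel0l N (v : 'cV[F]_N.+1) : parallel 0 v.
Proof. by apply: parallel_sym; rewrite -(scale0r v); apply: parallelZ. Qed.

Lemma parallel0r N (v : 'cV[F]_N.+1) : parallel v 0.
Proof. exact/parallel_sym/parallel0l. Qed.

Lemma parallelxx N (v : 'cV[F]_N.+1) : parallel v v.
Proof. by rewrite -{2}(scale1r v); apply: parallelZ. Qed.

Lemma singular_kernel N (M : 'M[F]_N) : M \notin unitmx ->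
  exists2 v : 'cV[F]_N, v != 0 & M *m v = 0.
Proof.
rewrite -unitmx_tr -row_free_unit -kermx_eq0 => /rowV0Pn[v /sub_kermxP vM v0].
exists v^T; first by apply: contra_neq v0 => v0; rewrite -[v]trmxK v0 trmx0.
by rewrite -[M]trmxK -trmx_mul vM trmx0.
Qed.

Lemma invmx_mul_neq0 N (M : 'M[F]_N) (v : 'cV_N) :
  M \in unitmx -> v != 0 -> invmx M *m v != 0.
Proof.
move=> M1; apply: contra_neq => Mv.
by rewrite -[v](mulKVmx M1) Mv mulmx0.
Qed.

(** Generically [x] is an eigenvector of [A^-1 C H^-1 G] and [y = H^-1 G x]. When
    one of the matrices is singular, a kernel vector makes one of the two
    conditions trivial and leaves enough freedom for the other. *)
Lemma deflating_vectors N (A C G H : 'M[F]_N.+1) :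
  exists x y : 'cV_N.+1, [/\ x != 0, y != 0,
    parallel (A *m x) (C *m y) & parallel (G *m x) (H *m y)].
Proof.
have [A1|/singular_kernel[x x0 Ax]] := boolP (A \in unitmx); last first.
  have [H1|/singular_kernel[y y0 Hy]] := boolP (H \in unitmx); last first.
    by exists x, y; rewrite Ax Hy; split=> //; [apply: parallel0l|apply: parallel0r].
  have [Gx|Gx] := eqVneq (G *m x) 0.
    by exists x, x; rewrite Ax Gx; split=> //; apply: parallel0l.
  exists x, (invmx H *m (G *m x)); rewrite Ax mulKVmx // invmx_mul_neq0 //.
  by split=> //; [apply: parallel0l|apply: parallelxx].
have [H1|/singular_kernel[y y0 Hy]] := boolP (H \in unitmx); last first.
  have [Cy|Cy] := eqVneq (C *m y) 0.
    by exists y, y; rewrite Hy Cy; split=> //; apply: parallel0r.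
  exists (invmx A *m (C *m y)), y; rewrite Hy mulKVmx // invmx_mul_neq0 //.
  by split=> //; [apply: parallelxx|apply: parallel0r].
pose M := invmx A *m C *m invmx H *m G.
have [mu /eigenvalueP[v vM v0]] := eigenvalue_closed M^T (ltn0Sn N).
have x0 : v^T != 0 by apply: contra_neq v0 => v0; rewrite -[v]trmxK v0 trmx0.
have : M *m v^T = mu *: v^T by rewrite -[M]trmxK -trmx_mul vM linearZ.
move: v^T x0 => x x0 Mx.
have [Gx|Gx] := eqVneq (G *m x) 0; last first.
  exists x, (invmx H *m (G *m x)); rewrite mulKVmx // invmx_mul_neq0 //.
  split=> //; last exact: parallelxx.
  have -> : C *m (invmx H *m (G *m x)) = mu *: (A *m x).
    by rewrite scalemxAr -Mx /M -!mulmxA mulKVmx.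
  exact: parallelZ.
have [C1|/singular_kernel[y y0 Cy]] := boolP (C \in unitmx); last first.
  by exists x, y; rewrite Gx Cy; split=> //; [apply: parallel0r|apply: parallel0l].
have Ax : A *m x != 0.
  by apply: contra_neq x0 => Ax; rewrite -[x](mulKmx A1) Ax mulmx0.
exists x, (invmx C *m (A *m x)); rewrite Gx mulKVmx // invmx_mul_neq0 //.
by split=> //; [apply: parallelxx|apply: parallel0l].
Qed.

Lemma complete_col N (x : 'cV[F]_(1 + N)) : x != 0 ->
  exists2 V : 'M[F]_(1 + N), V \in unitmx & V *m col_mx 1%:M 0 = x.
Proof.
move=> x0; have rx : \rank x = 1%N.
  by apply/eqP; rewrite eqn_leq rank_leq_col lt0n mxrank_eq0.
have := mulmx_ebase x; rewrite rx pid_mx_col [row_ebase x]mx11_scalar.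
set k := row_ebase x 0 0; rewrite mul_mx_scalar scalemxAl => ex.
exists (k *: col_ebase x); last by [].
rewrite unitmxZ ?col_ebase_unit // unitfE.
have := row_ebase_unit x; rewrite [row_ebase x]mx11_scalar unitmxE det_scalar1.
by rewrite unitfE.
Qed.

Lemma first_col_block N (M : 'M[F]_(1 + N)) a :
  M *m col_mx 1%:M 0 = a *: col_mx 1%:M 0 ->
  M = block_mx a%:M (ursubmx M) 0 (drsubmx M).
Proof.
rewrite -{1}[M]submxK mul_block_col !mulmx1 !mulmx0 !addr0 scale_col_mx scaler0.
by rewrite scalemx1 => /eq_col_mx[eul edl]; rewrite -{1}[M]submxK eul edl.
Qed.

(** Completing the deflating vectors and the lines that contain their images
    into bases puts [A], [C], [star D] and [star B] simultaneously in block
    upper triangular form, by substitutions that preserve the equation. *)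
Lemma deflation N (A B C D : 'M[F]_(1 + N)) :
  exists (P V W R : 'M[F]_(1 + N)) (a b c d : F) (A12 C12 : 'rV[F]_N)
      (B21 D21 : 'cV[F]_N) (A1 B1 C1 D1 : 'M[F]_N),
    [/\ P \in unitmx, V \in unitmx, W \in unitmx & R \in unitmx] /\
    [/\ P *m A *m V = block_mx a%:M A12 0 A1,
        W *m B *m R = block_mx b%:M 0 B21 B1,
        P *m C *m star s W = block_mx c%:M C12 0 C1 &
        star s V *m D *m R = block_mx d%:M 0 D21 D1].
Proof.
have [x [y [x0 y0 [u [a [c [u0 ea ec]]]] [w [d [b [w0 ed eb]]]]]]] :=
  deflating_vectors A C (star s D) (star s B).
have [V V1 eV] := complete_col x0; have [Y Y1 eY] := complete_col y0.
have [U U1 eU] := complete_col u0; have [Z Z1 eZ] := complete_col w0.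
have eU' : invmx U *m u = col_mx 1%:M 0 by rewrite -eU mulKmx.
have eZ' : invmx Z *m w = col_mx 1%:M 0 by rewrite -eZ mulKmx.
exists (invmx U), V, (star s Y), (star s (invmx Z)), a, (sconj s b), c, (sconj s d).
have eA : invmx U *m A *m V *m col_mx 1%:M 0 = a *: col_mx 1%:M 0.
  by rewrite -!mulmxA eV ea -scalemxAr eU'.
have eC : invmx U *m C *m Y *m col_mx 1%:M 0 = c *: col_mx 1%:M 0.
  by rewrite -!mulmxA eY ec -scalemxAr eU'.
have eD : invmx Z *m star s D *m V *m col_mx 1%:M 0 = d *: col_mx 1%:M 0.
  by rewrite -!mulmxA eV ed -scalemxAr eZ'.
have eB : invmx Z *m star s B *m Y *m col_mx 1%:M 0 = b *: col_mx 1%:M 0.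
  by rewrite -!mulmxA eY eb -scalemxAr eZ'.
move/first_col_block: eA; move/first_col_block: eC => eC eA.
move/first_col_block: eB; move/first_col_block: eD => eD eB.
exists (ursubmx (invmx U *m A *m V)), (ursubmx (invmx U *m C *m Y)).
exists (star s (ursubmx (invmx Z *m star s B *m Y))).
exists (star s (ursubmx (invmx Z *m star s D *m V))).
exists (drsubmx (invmx U *m A *m V)).
exists (star s (drsubmx (invmx Z *m star s B *m Y))).
exists (drsubmx (invmx U *m C *m Y)).
exists (star s (drsubmx (invmx Z *m star s D *m V))).
rewrite starK !star_unit !unitmx_inv; split=> //; split=> //.
  rewrite -[LHS](starK s).
  have -> : star s (star s Y *m B *m star s (invmx Z)) = invmx Z *m star s B *m Y.
    by rewrite !starM !starK mulmxA.
  rewrite {1}eB star_block star_scalar star0.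
  by [].
rewrite -[LHS](starK s).
  have -> : star s (star s V *m D *m star s (invmx Z)) = invmx Z *m star s D *m V.
    by rewrite !starM !starK mulmxA.
  rewrite {1}eD star_block star_scalar star0.
by [].
Qed.

(** Both the determinant of the pencil and that of the coupling matrix are
    values of this product, which is why the coefficient ring is arbitrary. *)
Definition pair_prod (K : comNzRingType) (f : {rmorphism F -> K}) (g h : K)
    (l : seq (F * F)) : K := \prod_(x <- l) (g * f x.1 - h * f x.2).

(** The list consists of the diagonal entries of a simultaneous triangular form:
    each deflation step contributes [(a * sconj s b, c * sconj s d)]. The list
    decides injectivity and factors the determinant of the pencil at the same
    time, including when the pencil is singular. *)
Theorem square_data N (A B C D : 'M[F]_N) :
  exists (l : seq (F * F)) (c : F),
    [/\ size l = N, c != 0, sylv_inj s A B C D <-> good s l &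
      forall (K : comNzRingType) (f : {rmorphism F -> K}) u v w z,
        \det (hpencil s f u v w z A B C D) = f c * pair_prod f (v * w) (u * z) l].
Proof.
elim: N A B C D => [|N IHN] A B C D.
  exists [::], 1; split=> //; first by rewrite oner_eq0.
    by split=> // _ X _; apply/matrixP => -[].
  by move=> K f u v w z; rewrite det_mx00 /pair_prod big_nil rmorph1 mulr1.
have [P [V [W [R [a [b [c [d [A12 [C12 [B21 [D21 [A1 [B1 [C1 [D1 [U E]]]]]]]]]]]]]]]]] :=
  @deflation N A B C D.
have [P1 V1 W1 R1] := U; have [eA eB eC eD] := E.
have [l [k [sl k0 inj_l det_l]]] := IHN A1 B1 C1 D1.
exists ((a * sconj s b, c * sconj s d) :: l).
(* The sign is that of the leading 2 x 2 determinant. *)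
exists (- k / (\det (star s R) * \det P * (\det V * \det (star s W)))).
set t := _ * (\det V * _).
have t0 : t != 0.
  by rewrite !mulf_neq0 // -unitfE -unitmxE ?star_unit.
split; first by rewrite /= sl.
- by rewrite mulf_neq0 ?oppr_eq0 ?invr_eq0.
- rewrite -(sylv_inj_equiv s A B C D P1 V1 W1 R1) eA eB eC eD sylv_inj_block.
  rewrite unitmxE unitfE det_star fmorph_eq0 det_l mulf_eq0 (negPf k0) /=.
  rewrite /pair_prod prodf_seq_neq0 /good /=.
  have -> : all (fun x => sconj s a * b * x.1 - sconj s c * d * x.2 != 0) l =
            all (cross_ok s (a * sconj s b, c * sconj s d)) l.
    apply: eq_all => x; rewrite /cross_ok /= !rmorphM /= !sconjK.
    by rewrite subr_eq0.
  split=> [[-> -> /inj_l/andP[-> ->]] //|/andP[/andP[-> ok_l] /andP[-> pw_l]]].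
  by split=> //; apply/inj_l/andP.
- move=> K f u v w z; have := gdet_hpencil_equiv s f A B C D P V W R u v w z.
  rewrite eA eB eC eD !gdetE det_hpencil_block det_l -/t => et.
  have : f t^-1 * (f t * \det (hpencil s f u v w z A B C D)) = \det (hpencil s f u v w z A B C D).
    by rewrite mulrA -rmorphM mulVf // rmorph1 mul1r.
  move=> <-; rewrite -et /pair_prod big_cons /= rmorphN1 !rmorphM rmorphN; ring.
Qed.

End SquareInduction.
(** * Rectangular equations *)

Section Compression.
Variable F : fieldType.

(** The rank of [M] is at most the number of its rows. *)
Lemma compress_left a b (M : 'M[F]_(a, a + b)) :
  exists2 V : 'M_(a + b), V \in unitmx & exists M1, M *m V = row_mx M1 0.
Proof.
exists (invmx (row_ebase M)); first by rewrite unitmx_inv row_ebase_unit.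
exists (lsubmx (M *m invmx (row_ebase M))).
rewrite -[LHS]hsubmxK; congr row_mx.
rewrite -[X in X *m _]mulmx_ebase mulmxK ?row_ebase_unit //.
rewrite -[pid_mx _]hsubmxK mul_mx_row row_mxKr.
rewrite (_ : rsubmx _ = 0) ?mulmx0 //; apply/matrixP => i j.
by rewrite !mxE /= ltn_eqF ?ltn_addr.
Qed.

Lemma compress_right a b (M : 'M[F]_(b, a + b)) :
  exists2 V : 'M_(a + b), V \in unitmx & exists M1, M *m V = row_mx 0 M1.
Proof.
have [V V1 [M1 eM]] := compress_left (M *m swap_mx F a b).
pose J := swap_mx F; exists (J a b *m V *m J b a); last first.
  exists M1; rewrite !mulmxA eM mul_row_block.
  by rewrite !(mulmx0, mulmx1) add0r addr0.
have : J a b *m V *m J b a *m (J a b *m invmx V *m J b a) = 1%:M.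
  by rewrite -!mulmxA (mulmxA (J b a)) swap_mxK mul1mx (mulmxA V) mulmxV // mul1mx swap_mxK.
by case/mulmx1_unit.
Qed.

End Compression.

Section PencilData.
Variables (F : numClosedFieldType) (s : star_kind).
Implicit Type l : seq (F * F).

(** The exponents [k1] and [k2] count the zero and the infinite eigenvalues that
    the shape of a rectangular equation forces. Two parameters suffice here,
    since only the pencil and its reversal are evaluated. *)
Definition pencil_data m n p q (A : 'M[F]_(p, m)) (B : 'M[F]_(n, q))
    (C : 'M[F]_(p, n)) (D : 'M[F]_(m, q)) (k1 k2 : nat) l : Prop :=
  [/\ (q + p = m + n)%N, (k1 + k2 + 2 * size l = q + p)%N,
      sylv_inj s A B C D <-> good s l &
      exists2 c : F, c != 0 & forall t u : {poly F},
        gdet (hpencil s polyC t u u t A B C D) =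
        c%:P * t ^+ k1 * u ^+ k2 * pair_prod polyC (u ^+ 2) (t ^+ 2) l].

Lemma square_pencil_data N (A B C D : 'M[F]_N) :
  exists l, pencil_data A B C D 0 0 l.
Proof.
have [l [c [sl c0 inj_l det_l]]] := square_data s A B C D.
exists l; split=> //; first by rewrite sl; lia.
by exists c => // t u; rewrite gdetE det_l !expr0 !mulr1 !expr2.
Qed.

(** After compression, the last [k] columns of [X] enter the equation only
    through [A *m Y2 *m G], so that they decouple from the square equation for
    the first [m] columns. *)
Section Wide.
Variables (m k : nat) (A B11 C1 D1 : 'M[F]_m) (B12 D2 : 'M[F]_(m, k)) (G : 'M[F]_k).
Let B : 'M_(m + k) := block_mx B11 B12 0 G.
Let C : 'M_(m, m + k) := row_mx C1 0.
Let D : 'M_(m, m + k) := row_mx D1 D2.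

Lemma sylv_rowE Y1 Y2 : sylv s A B C D (row_mx Y1 Y2) =
  row_mx (sylv s A B11 C1 D1 Y1)
         (A *m Y2 *m G + (A *m Y1 *m B12 + C1 *m star s Y1 *m D2)).
Proof.
rewrite /sylv star_row mul_row_col mul0mx addr0 mul_mx_row mul_row_block.
rewrite mulmx0 addr0 mul_mx_row add_row_mx; congr row_mx.
by rewrite [A *m Y1 *m B12 + A *m _ *m _]addrC -addrA.
Qed.

Lemma sylv_inj_wide : (0 < m)%N -> A \in unitmx ->
  sylv_inj s A B C D <-> G \in unitmx /\ sylv_inj s A B11 C1 D1.
Proof.
move=> m0 A1; split=> [S_inj|[G1 S_inj] Y].
  have G1 : G \in unitmx.
    rewrite -row_free_unit; apply: inj_row_free => v vG.
    have /S_inj /eqP : sylv s A B C D (row_mx 0 (const_mx 1 *m v)) = 0.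
      rewrite sylv_rowE sylv0 -!mulmxA vG star0 !(mulmx0, mul0mx) !addr0.
      by rewrite row_mx0.
    rewrite row_mx_eq0 eqxx /= => /eqP /matrixP v0; apply/rowP => j.
    have := v0 (Ordinal m0) j; rewrite !mxE big_ord1 !mxE mul1r => ->.
    by [].
  split=> // Y1 SY1.
  pose Y2 := - invmx A *m (A *m Y1 *m B12 + C1 *m star s Y1 *m D2) *m invmx G.
  have /S_inj /eqP : sylv s A B C D (row_mx Y1 Y2) = 0.
    rewrite sylv_rowE SY1 /Y2 !mulNmx mulmxN mulNmx -!mulmxA mulKVmx // mulVmx //.
    by rewrite mulmx1 addNr row_mx0.
  by rewrite row_mx_eq0 => /andP[/eqP].
move/eqP; rewrite -[Y]hsubmxK sylv_rowE row_mx_eq0 => /andP[/eqP/S_inj ->].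
rewrite star0 !(mulmx0, mul0mx) !addr0 => /eqP AYG.
by rewrite (unit_mul_eq0 A1 G1 AYG) row_mx0.
Qed.

(** Exchanging the block rows exposes the block [u *: star G] in a corner of a
    block triangular matrix; it accounts for the factor [u ^+ k]. *)
Lemma gdet_hpencil_wide : exists2 c : F, c != 0 & forall t u,
  gdet (hpencil s polyC t u u t A B C D) =
  (c * sconj s (\det G))%:P * u ^+ k * \det (hpencil s polyC t u u t A B11 C1 D1).
Proof.
have emk : (m + k + m = m + (m + k))%N by rewrite addnC.
pose J a b := swap_mx {poly F} a b.
have e1 t u : J m (m + k)%N *m hpencil s polyC t u u t A B C D =
    castmx (esym (addnA m m k), esym (addnA m m k))
      (block_mx (J m m *m hpencil s polyC t u u t A B11 C1 D1) 0
        (row_mx (t *: map_mx polyC (star s D2)) (u *: map_mx polyC (star s B12)))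
        (u *: map_mx polyC (star s G))).
  rewrite /hpencil !swap_mulmx star_block star_row map_row_mx map_col_mx map_block_mx.
  rewrite scale_row_mx scale_col_mx scale_block_mx star0 !map_mx0 !scaler0.
  by rewrite block_mxA col_mx0.
pose j := gdet (swap_mx F m (m + k)).
have j0 : j != 0 by exact: gdet_swap_neq0.
exists (j^-1 * \det (swap_mx F m m)).
  by rewrite mulf_neq0 ?invr_eq0 // -gdetE gdet_swap_neq0.
move=> t u; have := congr1 (@gdet _ _ _) (e1 t u).
rewrite gdet_cast gdetM // gdetE det_lblock det_mulmx.
rewrite detZ /J -!(map_swap_mx polyC) !det_map_mx det_star gdet_map -/j => e2.
transitivity (j^-1%:P * (j%:P * gdet (hpencil s polyC t u u t A B C D))).
  by rewrite mulrA -polyCM mulVf // mul1r.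
by rewrite e2 !polyCM /=; ring.
Qed.

End Wide.
End PencilData.
Section PencilDataTransfer.
Variables (F : numClosedFieldType) (s : star_kind).
Implicit Type l : seq (F * F).

Lemma pair_prod0 l : (0, 0) \in l ->
  forall g h : {poly F}, pair_prod polyC g h l = 0.
Proof.
move=> l0 g h; apply/eqP; rewrite /pair_prod prodf_seq_eq0; apply/hasP.
by exists (0, 0); rewrite //= !mulr0 subrr.
Qed.

Lemma good_neq0 l : good s l -> (0, 0) \notin l.
Proof.
case/andP => /allP ok_l _; apply/negP => /ok_l.
by rewrite /self_ok; case: s => /=; rewrite ?addr0 ?mulr0 eqxx.
Qed.

(** Compressing the columns of [C], and then the last rows of the transformed [B],
    reduces the equation to a square one. If the block [G] left over from [B]
    is singular, then both injectivity and regularity fail, which a list of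
    pairs [(0, 0)] records. *)
Lemma wide_pencil_data m k (A : 'M[F]_m) (B : 'M_(m + k)) (C D : 'M_(m, m + k)) :
  (0 < m)%N -> A \in unitmx -> exists l, pencil_data s A B C D 0 k l.
Proof.
move=> m0 A1; have [V V1 [C1 eC]] := compress_left C.
have [R R1 [G eG]] := compress_right (dsubmx (star s V *m B)).
pose B' := star s V *m B *m R; pose D' := star s 1%:M *m D *m R.
pose B11 := ulsubmx B'; pose B12 := ursubmx B'.
pose D1 := lsubmx D'; pose D2 := rsubmx D'.
have eA' : 1%:M *m A *m 1%:M = A by rewrite mul1mx mulmx1.
have eB' : B' = block_mx B11 B12 0 G.
  rewrite -[LHS]submxK; have : dsubmx B' = row_mx 0 G by rewrite /B' -mul_dsub_mx.
  by rewrite -[dsubmx B']hsubmxK /dlsubmx /drsubmx => /eq_row_mx[-> ->].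
have eC' : 1%:M *m C *m star s (star s V) = row_mx C1 0 by rewrite mul1mx starK.
have eD' : D' = row_mx D1 D2 by rewrite hsubmxK.
have W1 : star s V \in unitmx by rewrite star_unit.
have I1 := unitmx1 F m.
have := sylv_inj_equiv s A B C D I1 I1 W1 R1.
rewrite eA' eC' -/B' -/D' eB' eD' => inj_equiv.
have inj_wide := sylv_inj_wide s B11 C1 D1 B12 D2 G m0 A1.
have det_equiv u v := gdet_hpencil_equiv s polyC A B C D 1%:M 1%:M (star s V) R u v v u.
rewrite eA' eC' -/B' -/D' eB' eD' in det_equiv.
set t := _ * _ in det_equiv.
have t0 : t != 0.
  by rewrite !mulf_neq0 // -unitfE -unitmxE ?star_unit.
have [c c0 det_wide] := gdet_hpencil_wide s A B11 C1 D1 B12 D2 G.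
have det_hpencil u v : gdet (hpencil s polyC u v v u A B C D) =
    (t^-1 * (c * sconj s (\det G)))%:P * v ^+ k
      * \det (hpencil s polyC u v v u A B11 C1 D1).
  transitivity (t^-1%:P * (t%:P * gdet (hpencil s polyC u v v u A B C D))).
    by rewrite mulrA -polyCM mulVf // mul1r.
  by rewrite -det_equiv det_wide !polyCM -!mulrA.
have esz : (m + k + m = m + (m + k))%N by lia.
have [G1|G1] := boolP (G \in unitmx); last first.
  exists (nseq m (0, 0)).
  have l0 : (0, 0) \in nseq m ((0, 0) : F * F) by rewrite mem_nseq m0 eqxx.
  split=> //; first by rewrite size_nseq; lia.
    split; first by move/inj_equiv/inj_wide => -[]; rewrite (negPf G1).
    by move=> /good_neq0/negP/(_ l0).
  exists 1; first exact: oner_neq0.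
  move=> u v; rewrite pair_prod0 // mulr0 det_hpencil.
  move: G1; rewrite unitmxE unitfE negbK => /eqP ->.
  by rewrite rmorph0 !mulr0 !mul0r.
have [l [_ szl inj_l [c1 c10 det_l]]] := square_pencil_data s A B11 C1 D1.
exists l; split=> //; first by lia.
  split; first by move/inj_equiv/inj_wide => -[_ /inj_l].
  by move=> /inj_l S_inj; apply/inj_equiv/inj_wide.
exists (t^-1 * (c * sconj s (\det G)) * c1).
  by rewrite !mulf_neq0 ?invr_eq0 ?fmorph_eq0 // -unitfE -unitmxE.
by move=> u v; rewrite det_hpencil -gdetE det_l !polyCM /=; ring.
Qed.

Lemma pencil_data_star m n p q (A : 'M[F]_(p, m)) (B : 'M[F]_(n, q))
    (C : 'M[F]_(p, n)) (D : 'M[F]_(m, q)) k1 k2 l :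
  pencil_data s (star s B) (star s A) (star s D) (star s C) k1 k2 l ->
  pencil_data s A B C D k1 k2 l.
Proof.
case=> e szl inj_l [c c0 det_l].
have e' : (q + p = m + n)%N by rewrite addnC e addnC.
split=> //; first by rewrite szl addnC.
  split; first by move/sylv_inj_star/inj_l.
  by move/inj_l/sylv_inj_star.
pose j := gdet (swap_mx F p q) * gdet (swap_mx F m n).
have j0 : j != 0 by rewrite mulf_neq0 ?gdet_swap_neq0.
exists (j^-1 * c); first by rewrite mulf_neq0 ?invr_eq0.
move=> t u; transitivity (j^-1%:P * (j%:P * gdet (hpencil s polyC t u u t A B C D))).
  by rewrite mulrA -polyCM mulVf // mul1r.
have := det_l t u; rewrite hpencil_star !gdetM ?[(p + q)%N]addnC //.
rewrite -!(map_swap_mx polyC) !gdet_map => ej.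
by rewrite polyCM mulrAC ej !polyCM /=; ring.
Qed.

(** Passing to the reversal turns [u^2 x.1 - t^2 x.2] into
    [t^2 x.1 - u^2 x.2]; the signs keep the product in the same shape. *)
Definition swap_pair (x : F * F) : F * F := (- x.2, - x.1).

Lemma good_swap l : good s (map swap_pair l) = good s l.
Proof.
rewrite /good all_map pairwise_map; congr (_ && _).
  apply: eq_all => x; rewrite /self_ok /=; case: s.
    by rewrite -opprD oppr_eq0 addrC.
  by rewrite !rmorphN !mulrNN eq_sym.
by apply: eq_pairwise => x y; rewrite /cross_ok /= !rmorphN !mulrNN eq_sym.
Qed.

Lemma pencil_data_swap m n p q (A : 'M[F]_(p, m)) (B : 'M[F]_(n, q))
    (C : 'M[F]_(p, n)) (D : 'M[F]_(m, q)) k1 k2 l :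
  pencil_data s C D A B k1 k2 l -> pencil_data s A B C D k2 k1 (map swap_pair l).
Proof.
case=> e szl inj_l [c c0 det_l].
split; first by rewrite e addnC.
- by rewrite size_map -szl [(k2 + _)%N]addnC.
- rewrite good_swap; split; first by move/sylv_inj_swap/inj_l.
  by move/inj_l/sylv_inj_swap.
have j0 := gdet_swap_neq0 F n m.
exists (c * gdet (swap_mx F n m)); first by rewrite mulf_neq0.
move=> t u; rewrite hpencil_swap gdetM // det_l -(map_swap_mx polyC) gdet_map.
have -> : pair_prod polyC (u ^+ 2) (t ^+ 2) (map swap_pair l) =
    pair_prod polyC (t ^+ 2) (u ^+ 2) l.
  rewrite /pair_prod big_map; apply: eq_bigr => x _.
  by rewrite /= !rmorphN !mulrN opprK addrC.
by rewrite polyCM; ring.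
Qed.

End PencilDataTransfer.

Arguments swap_pair {F} x.
(** * Spectral conditions read off the list of pairs *)

Section PairPolynomial.
Variable F : numClosedFieldType.
Implicit Types (x : F * F) (l : seq (F * F)) (a : F).

Definition pair_poly x : {poly F} := x.1%:P - x.2 *: 'X^2.

Definition pair_root a x : bool := x.1 == a ^+ 2 * x.2.

Lemma pair_prodE l :
  pair_prod polyC 1 ('X ^+ 2) l = \prod_(x <- l) pair_poly x.
Proof.
by apply: eq_bigr => x _; rewrite mul1r /= mulrC mul_polyC.
Qed.

Lemma pair_prod_revE l :
  pair_prod polyC ('X ^+ 2) 1 l = \prod_(x <- map swap_pair l) pair_poly x.
Proof.
rewrite /pair_prod big_map; apply: eq_bigr => x _; rewrite /pair_poly /=.
by rewrite mul1r mulrC mul_polyC polyCN scaleNr opprK addrC.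
Qed.

Lemma size_pair_poly x : x != (0, 0) ->
  size (pair_poly x) = (2 * (x.2 != 0)).+1.
Proof.
case: x => x1 x2; rewrite xpair_eqE negb_and /pair_poly /=.
have [->|x20] := eqVneq x2 0.
  by rewrite orbF scale0r subr0 size_polyC => ->.
move=> _; rewrite addrC size_polyDl ?size_polyN ?size_scale ?size_polyXn //.
by rewrite size_polyC; case: eqP.
Qed.

Lemma pair_poly_neq0 x : x != (0, 0) -> pair_poly x != 0.
Proof. by move=> x0; rewrite -size_poly_eq0 size_pair_poly. Qed.

Lemma pair_polys_neq0 l : (0, 0) \notin l -> \prod_(x <- l) pair_poly x != 0.
Proof.
move=> l0; rewrite prodf_seq_neq0; apply/allP => x xl /=.
by apply: pair_poly_neq0; apply: contraNneq l0 => <-.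
Qed.

Lemma size_pair_polys l : (0, 0) \notin l ->
  size (\prod_(x <- l) pair_poly x) = (2 * count (fun x => x.2 != 0%R) l).+1.
Proof.
elim: l => [|x l IHl]; first by rewrite big_nil size_poly1.
rewrite inE negb_or eq_sym => /andP[x0 l0]; rewrite big_cons.
rewrite size_mul ?pair_poly_neq0 ?pair_polys_neq0 // IHl // size_pair_poly //=.
lia.
Qed.

Lemma root_pair_poly a x : root (pair_poly x) a = pair_root a x.
Proof.
by rewrite rootE /pair_poly hornerD hornerN hornerC hornerZ hornerXn subr_eq0 mulrC.
Qed.

Lemma root_pair_polys a l :
  root (\prod_(x <- l) pair_poly x) a = has (pair_root a) l.
Proof.
elim: l => [|x l IHl]; first by rewrite big_nil (negPf (root1 _)).
by rewrite big_cons rootM IHl root_pair_poly.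
Qed.

Lemma mup_pair_poly a x : x != (0, 0) -> a != 0 ->
  mup a (pair_poly x) = pair_root a x.
Proof.
case: x => x1 x2 x0 a0; have [ra|ra] := boolP (pair_root a _); last first.
  by apply: mupNroot; rewrite root_pair_poly.
move: ra x0; rewrite /pair_root /= => /eqP ->.
rewrite xpair_eqE mulf_eq0 sqrf_eq0 (negPf a0) orFb andbb => x20.
have -> : pair_poly (a ^+ 2 * x2, x2) = (- x2)%:P * ('X - (- a)%:P) * ('X - a%:P) ^+ 1.
  rewrite /pair_poly /= -mul_polyC !polyCM !polyCN; ring.
rewrite mupMr; first by rewrite mup_XsubCX eqxx.
rewrite rootM rootC root_XsubC oppr_eq0 (negPf x20) /= -subr_eq0 opprK.
by rewrite -mulr2n mulrn_eq0 negb_or a0.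
Qed.

Lemma mup0_pair_poly x : x != (0, 0) ->
  mup 0 (pair_poly x) = (2 * (x.1 == 0%R))%N.
Proof.
case: x => x1 x2 x0 /=; have [x10|x10] := eqVneq x1 0; last first.
  by apply: mupNroot; rewrite root_pair_poly /pair_root /= expr0n mul0r.
have x20 : x2 != 0 by move: x0; rewrite x10 xpair_eqE eqxx.
have -> : pair_poly (x1, x2) = (- x2)%:P * ('X - 0%:P) ^+ 2.
  by rewrite /pair_poly /= x10 subr0 polyC0 add0r mul_polyC scaleNr.
by rewrite mupMr ?rootC ?oppr_eq0 // mup_XsubCX eqxx.
Qed.

Lemma mup_pair_polys a l : (0, 0) \notin l -> a != 0 ->
  mup a (\prod_(x <- l) pair_poly x) = count (pair_root a) l.
Proof.
move=> + a0; elim: l => [|x l IHl]; first by rewrite big_nil mupNroot ?root1.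
rewrite inE negb_or eq_sym => /andP[x0 l0]; rewrite big_cons.
by rewrite mupM ?pair_poly_neq0 ?pair_polys_neq0 // IHl // mup_pair_poly.
Qed.

Lemma mup0_pair_polys l : (0, 0) \notin l ->
  mup 0 (\prod_(x <- l) pair_poly x) = (2 * count (fun x => x.1 == 0%R) l)%N.
Proof.
elim: l => [|x l IHl]; first by rewrite big_nil mupNroot ?root1.
rewrite inE negb_or eq_sym => /andP[x0 l0]; rewrite big_cons.
by rewrite mupM ?pair_poly_neq0 ?pair_polys_neq0 // IHl // mup0_pair_poly // mulnDr.
Qed.

Lemma swap_pairs_neq0 l : (0, 0) \notin l -> (0, 0) \notin map swap_pair l.
Proof.
move=> l0; apply/mapP => -[[x1 x2] xl]; rewrite /swap_pair /= => -[e1 e2].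
move/eqP: e1 e2; rewrite eq_sym oppr_eq0 => /eqP e1 /eqP.
rewrite eq_sym oppr_eq0 => /eqP e2; subst x1 x2.
by rewrite xl in l0.
Qed.

End PairPolynomial.

Section SpectrumOfData.
Variables (F : numClosedFieldType) (s : star_kind) (m n p q : nat).
Variables (A : 'M[F]_(p, m)) (B : 'M[F]_(n, q)) (C : 'M[F]_(p, n)) (D : 'M[F]_(m, q)).
Let Q := sylvester_pencil s A B C D.

Lemma sylvester_detE : pencil_det Q = gdet (hpencil s polyC 'X 1 1 'X A B C D).
Proof.
rewrite /pencil_det -/(gdet (pencil_mx Q)); congr gdet.
rewrite /pencil_mx /hpencil /= !map_block_mx !map_mx0 scale_block_mx add_block_mx.
by rewrite !scaler0 !addr0 !add0r !scale1r.
Qed.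

Lemma reversal_detE : pencil_det (reversal Q) = gdet (hpencil s polyC 1 'X 'X 1 A B C D).
Proof.
rewrite /pencil_det -/(gdet (pencil_mx (reversal Q))); congr gdet.
rewrite /pencil_mx /hpencil /= !map_block_mx !map_mx0 scale_block_mx add_block_mx.
by rewrite !scaler0 !addr0 !add0r !scale1r.
Qed.

Variables (k1 k2 : nat) (l : seq (F * F)).
Hypothesis data : pencil_data s A B C D k1 k2 l.

Lemma sylvester_det_data : exists2 c : F, c != 0 &
  pencil_det Q = c *: ('X^k1 * \prod_(x <- l) pair_poly x) /\
  pencil_det (reversal Q) = c *: ('X^k2 * \prod_(x <- map swap_pair l) pair_poly x).
Proof.
have [_ _ _ [c c0 det_l]] := data; exists c => //.
rewrite sylvester_detE reversal_detE !det_l !expr1n !mulr1.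
by rewrite pair_prodE pair_prod_revE -!mulrA !mul_polyC.
Qed.

Lemma regular_data : regular_pencil Q <-> (0, 0) \notin l.
Proof.
have [c c0 [detQ _]] := sylvester_det_data; have [e _ _ _] := data.
rewrite /regular_pencil /singular_pencil detQ; split=> [reg|l0].
  apply/negP => l0; apply: reg; right.
  by rewrite -pair_prodE pair_prod0 // mulr0 scaler0.
case=> // /eqP; rewrite scaler_eq0 (negPf c0) mulf_eq0 expf_eq0 polyX_eq0 andbF /=.
by rewrite (negPf (pair_polys_neq0 l0)).
Qed.

Hypothesis l0 : (0, 0) \notin l.

(** The eigenvalues contributed by the list, without those forced by the shape:
    these are the core eigenvalues in each of the three situations. *)
Definition core_set : set (option F) :=
  [set z | if z is Some a then has (pair_root a) l else has (fun x => x.2 == 0) l].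

Lemma spectrum_data z : spectrum Q z <->
  [\/ core_set z, z = Some 0 /\ (0 < k1)%N | z = None /\ (0 < k2)%N].
Proof.
have [c c0 [detQ _]] := sylvester_det_data; have [e szl _ _] := data.
rewrite /spectrum /core_set /mkset detQ; case: z => [a|].
  rewrite rootZ // rootM root_pair_polys orbC.
  have -> : root ('X^k1 : {poly F}) a = (a == 0) && (0 < k1)%N.
    by rewrite rootE hornerXn expf_eq0 andbC.
  split; last by case=> [->|[[->] ->]|[]] //; rewrite eqxx orbT.
  by case/orP => [->|/andP[/eqP -> ->]]; [apply: Or31|apply: Or32].
rewrite size_scale // [_ * \prod_(_ <- _) _]mulrC size_mulXn ?pair_polys_neq0 // size_pair_polys //.
have := count_predC (fun x : F * F => x.2 == 0) l.
rewrite has_count /predC; set c1 := count _ l; set c2 := count _ l => ec.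
split; last by case=> [|[]|[]] //; lia.
by have [?|?] := ltnP 0 k2; [move=> _; apply: Or33|move=> ?; apply: Or31; lia].
Qed.

Lemma mult_infty_data : multiplicity None Q = (k2 + 2 * count (fun x => x.2 == 0%R) l)%N.
Proof.
have [c c0 [_ detR]] := sylvester_det_data.
rewrite /multiplicity detR -mul_polyC mupMr ?rootC // mupM; last first.
- exact/pair_polys_neq0/swap_pairs_neq0.
- by rewrite expf_eq0 polyX_eq0 andbF.
rewrite mup0_pair_polys ?swap_pairs_neq0 // count_map -['X]subr0 -polyC0 mup_XsubCX eqxx.
congr (_ + 2 * _)%N; apply: eq_count => x /=; exact: oppr_eq0.
Qed.

Lemma mult_zero_data : multiplicity (Some 0) Q = (k1 + 2 * count (fun x => x.1 == 0%R) l)%N.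
Proof.
have [c c0 [detQ _]] := sylvester_det_data.
rewrite /multiplicity detQ -mul_polyC mupMr ?rootC // mupM; last first.
- exact/pair_polys_neq0.
- by rewrite expf_eq0 polyX_eq0 andbF.
by rewrite mup0_pair_polys // -['X]subr0 -polyC0 mup_XsubCX eqxx.
Qed.

Lemma mult_data a : a != 0 -> multiplicity (Some a) Q = count (pair_root a) l.
Proof.
move=> a0; have [c c0 [detQ _]] := sylvester_det_data.
rewrite /multiplicity detQ -mul_polyC mupMr ?rootC // mupMr ?mup_pair_polys //.
by rewrite rootE hornerXn expf_eq0 (negPf a0) andbF.
Qed.

Lemma core_infty_data : k1 = 0%N -> core_spectrum None k2 Q = core_set.
Proof.
move=> k10; rewrite /core_spectrum mult_infty_data -{1}[k2]addn0 ltn_add2l.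
rewrite muln_gt0 /= -has_count; apply/seteqP; case: ifP => hl; split=> z.
- by case/spectrum_data => [//|[_]|[-> _]]; [rewrite k10|rewrite /core_set /mkset hl].
- by move=> cz; apply/spectrum_data; apply: Or31.
- by case=> /spectrum_data[//|[_]|[-> _]]; [rewrite k10|case].
- move=> cz; split; first by apply/spectrum_data; apply: Or31.
  by move=> /= z0; move: cz; rewrite z0 /core_set /mkset hl.
Qed.

Lemma core_zero_data : k2 = 0%N -> core_spectrum (Some 0) k1 Q = core_set.
Proof.
move=> k20; rewrite /core_spectrum mult_zero_data -{1}[k1]addn0 ltn_add2l.
rewrite muln_gt0 /= -has_count.
have e0 : has (fun x : F * F => x.1 == 0) l = has (pair_root 0) l.
  by apply: eq_has => x; rewrite /pair_root expr0n mul0r.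
rewrite e0; apply/seteqP; case: ifP => hl; split=> z.
- by case/spectrum_data => [//|[-> _]|[_]]; [rewrite /core_set /mkset hl|rewrite k20].
- by move=> cz; apply/spectrum_data; apply: Or31.
- by case=> /spectrum_data[//|[-> _]|[_]]; [case|rewrite k20].
- move=> cz; split; first by apply/spectrum_data; apply: Or31.
  by move=> /= z0; move: cz; rewrite z0 /core_set /mkset hl.
Qed.

Lemma spectrum_square_data : k1 = 0%N -> k2 = 0%N -> spectrum Q = core_set.
Proof.
move=> k10 k20; apply/seteqP; split=> z.
  by case/spectrum_data => // -[_]; rewrite ?k10 ?k20.
by move=> cz; apply/spectrum_data; apply: Or31.
Qed.

End SpectrumOfData.
Section GoodLists.
Variables (F : numClosedFieldType) (s : star_kind).
Implicit Types (x y : F * F) (z : option F) (l : seq (F * F)).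

(** A pair contributes [a] and [- a], where [a ^+ 2 = x.1 / x.2], with infinity
    when [x.2 = 0]. *)
Definition pair_at z x : bool := if z is Some a then pair_root a x else x.2 == 0.

Definition star_inv z : option F := ext_inv (omap (sconj s) z).

Lemma cross_okC x y : cross_ok s x y = cross_ok s y x.
Proof.
rewrite /cross_ok -(inj_eq (inv_inj (@sconjK F s))) !rmorphM /= !sconjK.
by rewrite mulrC [sconj s y.2 * _]mulrC.
Qed.

(** The equation [sconj x.1 * y.1 = sconj x.2 * y.2] says that the ratio of [y]
    is the inverse of the twisted ratio of [x]; square roots of these ratios
    are the eigenvalues of the pencil. *)
Lemma cross_okPn x y : x != (0, 0) -> y != (0, 0) ->
  reflect (exists2 z, pair_at z x & pair_at (star_inv z) y) (~~ cross_ok s x y).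
Proof.
case: x => x1 x2; case: y => y1 y2; rewrite !xpair_eqE !negb_and /cross_ok negbK /=.
move=> x0 y0; apply: (iffP eqP) => [e|]; last first.
  case=> [[a|]]; last first.
    rewrite /= /pair_root expr0n mul0r /= => /eqP -> /eqP ->.
    by rewrite rmorph0 mulr0 mul0r.
  rewrite /pair_root /star_inv /= fmorph_eq0 => /eqP /= ->.
  have [->|a0] := eqVneq a 0; rewrite /pair_at /pair_root /= => /eqP ->.
    by rewrite expr0n mul0r rmorph0 mul0r mulr0.
  rewrite rmorphM rmorphXn /= exprVn mulrACA mulfV ?mul1r //.
  by rewrite expf_eq0 /= fmorph_eq0.
have [x20|x20] := eqVneq x2 0.
  exists None; first by rewrite /= x20.
  move: x0 e; rewrite x20 eqxx orbF rmorph0 mul0r => x10 /eqP.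
  rewrite mulf_eq0 fmorph_eq0 (negPf x10) /= => /eqP ->.
  by rewrite /= /pair_root expr0n mul0r.
pose a := sqrtC (x1 / x2); have ea : x1 = a ^+ 2 * x2 by rewrite sqrtCK divfK.
exists (Some a); first by rewrite /= /pair_root -ea.
have x2c : sconj s x2 != 0 by rewrite fmorph_eq0.
have {}e : y2 = sconj s a ^+ 2 * y1.
  apply: (mulfI x2c); rewrite -e ea rmorphM rmorphXn /=; ring.
rewrite /star_inv /= fmorph_eq0; have [a0|a0] := eqVneq a 0.
  by rewrite /= e a0 rmorph0 expr0n mul0r.
by rewrite /= /pair_root e exprVn mulKf // expf_eq0 /= fmorph_eq0.
Qed.

Lemma good_cross l x y : good s l -> x \in l -> y \in l -> x != y -> cross_ok s x y.
Proof.
case/andP => _; elim: l => //= w l IHl /andP[/allP w_ok pw].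
rewrite !inE => /predU1P[->|xl] /predU1P[->|yl].
- by rewrite eqxx.
- by move=> _; apply: w_ok.
- by move=> _; rewrite cross_okC; apply: w_ok.
- exact: IHl.
Qed.

End GoodLists.

(** For the conjugate star, the condition on a single pair is the cross condition
    of the pair with itself. *)
Lemma good_conj (F : numClosedFieldType) (l : seq (F * F)) :
  good ConjTranspose l <-> {in l &, forall x y, cross_ok ConjTranspose x y}.
Proof.
split=> [good_l x y xl yl|ok_l].
  have [->|/(good_cross good_l xl yl) //] := eqVneq x y.
  by case/andP: good_l => /allP /(_ y yl).
apply/andP; split; first by apply/allP => x xl; apply: (ok_l x x).
elim: l ok_l => //= x l IHl ok_l; apply/andP; split.
  by apply/allP => y yl; apply: ok_l; rewrite inE ?eqxx ?yl ?orbT.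
by apply: IHl => y w yl wl; apply: ok_l; rewrite inE ?yl ?wl orbT.
Qed.

(** For the transpose, a pair with ratio 1 fails the cross condition with itself
    but is admissible alone; a pair with ratio -1 fails both conditions. Hence
    the exception made for the eigenvalues 1 and -1, up to multiplicity one. *)
Lemma good_transpose (F : numClosedFieldType) (l : seq (F * F)) : (0, 0) \notin l ->
  good Transpose l <->
  {in l &, forall x y, ~~ cross_ok Transpose x y -> x.1 = x.2 /\ y.1 = y.2} /\
  (count (pair_root 1) l <= 1)%N.
Proof.
have rootE1 (x : F * F) : pair_root 1 x = (x.1 == x.2).
  by rewrite /pair_root expr1n mul1r.
move=> l0; split=> [good_l|[cross_l count_l]].
  split=> [x y xl yl|].
    have [<-|/(good_cross good_l xl yl) -> //] := eqVneq x y.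
    rewrite /cross_ok /= negbK -!expr2 eqf_sqr => /orP[/eqP //|e].
    case/andP: good_l => /allP /(_ x xl) /=.
    by rewrite -addr_eq0 in e; rewrite e.
  case/andP: good_l => _ /(pairwise_filter (pair_root 1)).
  rewrite -size_filter; case E: (filter _ l) => [|x [|y r]] //=.
  have xF : x \in filter (pair_root 1) l by rewrite E mem_head.
  have yF : y \in filter (pair_root 1) l by rewrite E !inE eqxx orbT.
  move: xF yF; rewrite !mem_filter !rootE1 => /andP[/eqP x1 _] /andP[/eqP y1 _].
  by rewrite /cross_ok /= x1 y1 eqxx.
apply/andP; split.
  apply/allP => x xl; apply/negP => /= x12.
  have x12' : x.1 = - x.2 by apply/eqP; rewrite -addr_eq0.
  have [] := cross_l x x xl xl; first by rewrite /cross_ok /= negbK x12' mulrNN.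
  move: x12 => /eqP + xe _; rewrite xe -mulr2n -mulr_natr => /eqP.
  rewrite mulf_eq0 (negPf (two_neq0 F)) orbF => /eqP x20.
  by move: xl l0; rewrite [x]surjective_pairing xe x20 => ->.
elim: l cross_l count_l {l0} => //= x l IHl cross_l count_l; apply/andP; split.
  apply/allP => y yl; apply: contraT => ok_xy.
  have [x1 y1] : x.1 = x.2 /\ y.1 = y.2.
    by apply: cross_l; rewrite // inE ?eqxx ?yl ?orbT.
  move: count_l; rewrite rootE1 x1 eqxx add1n ltnS leqn0 -leqn0 leqNgt -has_count.
  by case/hasP; exists y; rewrite // rootE1 y1.
apply: IHl; last exact: leq_trans (leq_addl _ _) count_l.
by move=> y w yl wl; apply: cross_l; rewrite inE ?yl ?wl orbT.
Qed.

Section SpectralCondition.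
Variables (F : numClosedFieldType) (s : star_kind) (m n p q : nat).
Variables (A : 'M[F]_(p, m)) (B : 'M[F]_(n, q)) (C : 'M[F]_(p, n)) (D : 'M[F]_(m, q)).
Variables (k1 k2 : nat) (l : seq (F * F)).

Lemma core_setP z : core_set l z <-> exists2 x, x \in l & pair_at z x.
Proof. by split; case: z => [a|] /hasP. Qed.

(** A violated cross condition is a reciprocal pair of core eigenvalues, and
    the multiplicity of 1, equal to that of -1 because the determinant is an even
    or an odd polynomial, counts the pairs with ratio 1. *)
Lemma spectral_condition_data : pencil_data s A B C D k1 k2 l -> (0, 0) \notin l ->
  spectral_condition s (sylvester_pencil s A B C D) (core_set l) <-> good s l.
Proof.
move=> data l0.
have nz x : x \in l -> x != (0, 0) by move=> xl; apply: contraNneq l0 => <-.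
rewrite /spectral_condition; case: s data => data.
- rewrite !(mult_data data l0) ?oppr_eq0 ?oner_neq0 // good_transpose //.
  have -> : count (pair_root (-1)) l = count (pair_root 1) l.
    by apply: eq_count => x; rewrite /pair_root sqrrN.
  split=> [[rf [_ count_l]]|[cross_l count_l]]; split=> //.
    move=> x y xl yl /(cross_okPn _ (nz x xl) (nz y yl))[z xz yz].
    have zC : core_set l z by apply/core_setP; exists x.
    have z'C : core_set l (ext_inv z).
      by apply/core_setP; exists y => //; move: yz; rewrite /star_inv; case: (z).
    have [z1|zN1] := boolP ((z == Some 1) || (z == Some (-1))).
      have ez : exists2 a : F, a ^+ 2 = 1 & z = Some a.
        by case/orP: z1 => /eqP ->; [exists 1|exists (-1)]; rewrite ?sqrrN ?expr1n.
      case: ez xz yz => a a2 ->; rewrite /star_inv /= /pair_root a2 mul1r => /eqP ->.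
      have a0 : a != 0 by apply: contra_eq_neq a2 => ->; rewrite expr0n eq_sym oner_neq0.
      by rewrite (negPf a0) /= /pair_root exprVn a2 invr1 mul1r => /eqP.
    have {}zN1 : ~ (z = Some 1 \/ z = Some (-1)).
      by case=> ez; rewrite ez eqxx ?orbT in zN1.
    have z'N1 : ~ (ext_inv z = Some 1 \/ ext_inv z = Some (-1)).
      case: (z) zN1 => [a|] zN1; last first.
        by rewrite /=; case=> -[] /eqP; rewrite eq_sym ?oppr_eq0 oner_eq0.
      rewrite /=; case: eqP => [_|_]; first by case.
      case=> -[e]; apply: zN1; [left|right].
        by rewrite -[a]invrK e invr1.
      by rewrite -[a]invrK e invrN invr1.
    by have := rf (ext_inv z) z (conj z'C z'N1) (conj zC zN1).
  move=> x y [/core_setP[e el ex] xN1] [/core_setP[e' e'l ey] yN1] exy.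
  have [|e'1 e1] := cross_l e' e e'l el.
    apply/(cross_okPn _ (nz _ e'l) (nz _ el)); exists y => //.
    by rewrite /star_inv; move: ex; rewrite exy; case: (y).
  have e'20 : e'.2 != 0.
    by move: (nz _ e'l); rewrite [e']surjective_pairing e'1 xpair_eqE andbb.
  case: y ey yN1 {exy} => [b|/eqP e0]; last by rewrite e0 eqxx in e'20.
  rewrite /= /pair_root e'1 -{1}[e'.2]mul1r (inj_eq (mulIf e'20)) eq_sym sqrf_eq1.
  by case/orP => /eqP ->; apply; [left|right].
- rewrite good_conj; split=> [rf x y xl yl|cross_l x y].
    apply: contraT => /(cross_okPn _ (nz x xl) (nz y yl))[z xz yz].
    have /(_ _ _) [] := rf (star_inv ConjTranspose z) z; rewrite //.
      by apply/core_setP; exists y.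
    by apply/core_setP; exists x.
  move=> /core_setP[e el ex] /core_setP[e' e'l ey] exy.
  have := cross_l _ _ e'l el; apply/negP.
  by apply/(cross_okPn _ (nz _ e'l) (nz _ el)); exists y => //; rewrite exy in ex.
Qed.
End SpectralCondition.
(** * The criterion *)

Section Criterion.
Variables (F : numClosedFieldType) (s : star_kind).

(** Regularity and admissibility both exclude the pair [(0, 0)], so that the
    description of the core eigenvalues is only needed without it. *)
Lemma inj_spectral_criterion m n p q (A : 'M[F]_(p, m)) (B : 'M[F]_(n, q))
    (C : 'M[F]_(p, n)) (D : 'M[F]_(m, q)) k1 k2 l (S : set (option F)) :
  pencil_data s A B C D k1 k2 l -> ((0, 0) \notin l -> S = core_set l) ->
  let Q := sylvester_pencil s A B C D in
  sylv_inj s A B C D <-> regular_pencil Q /\ spectral_condition s Q S.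
Proof.
move=> data eS Q; have [_ _ inj_l _] := data.
split=> [/inj_l good_l|[/(regular_data data) l0]].
  have l0 := good_neq0 good_l; split; first exact/(regular_data data).
  by rewrite eS //; apply/(spectral_condition_data data).
by rewrite eS // => /(spectral_condition_data data l0)/inj_l.
Qed.

Lemma square_criterion N (A B C D : 'M[F]_N) :
  let Q := sylvester_pencil s A B C D in
  sylv_inj s A B C D <-> regular_pencil Q /\ spectral_condition s Q (spectrum Q).
Proof.
have [l data] := square_pencil_data s A B C D.
by apply: (inj_spectral_criterion data) => l0; apply: (spectrum_square_data data).
Qed.

(** If [B] rather than [A] is the invertible matrix, starring the equation
    exchanges their roles. *)
Lemma rect_pencil_data m n (A : 'M[F]_m) (B : 'M[F]_n) (C D : 'M[F]_(m, n)) :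
  (0 < m)%N -> (0 < n)%N ->
  ((m < n)%N /\ A \in unitmx) \/ ((n < m)%N /\ B \in unitmx) ->
  exists l, pencil_data s A B C D 0 `|m - n|%N l.
Proof.
move=> m0 n0 [[lt A1]|[lt B1]].
  have [k ek] : exists k, n = (m + k)%N by exists (n - m)%N; lia.
  subst n; have -> : `|m - (m + k)%N|%N = k by lia.
  exact: wide_pencil_data.
have [k ek] : exists k, m = (n + k)%N by exists (m - n)%N; lia.
subst m; have -> : `|(n + k)%N - n|%N = k by lia.
rewrite -(star_unit s) in B1.
have [l data] := wide_pencil_data s (star s A) (star s D) (star s C) n0 B1.
by exists l; apply: pencil_data_star.
Qed.

Lemma infty_core_criterion m n (A : 'M[F]_m) (B : 'M[F]_n) (C D : 'M[F]_(m, n)) :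
  (0 < m)%N -> (0 < n)%N ->
  ((m < n)%N /\ A \in unitmx) \/ ((n < m)%N /\ B \in unitmx) ->
  let Q := sylvester_pencil s A B C D in
  sylv_inj s A B C D <->
  regular_pencil Q /\ spectral_condition s Q (core_spectrum None `|m - n|%N Q).
Proof.
move=> m0 n0 AB1; have [l data] := rect_pencil_data C D m0 n0 AB1.
by apply: (inj_spectral_criterion data) => l0; apply: (core_infty_data data).
Qed.

(** Exchanging the unknown with its star turns the forced zero eigenvalues into
    forced infinite ones. *)
Lemma zero_core_criterion m n (A B : 'M[F]_(n, m)) (C : 'M[F]_n) (D : 'M[F]_m) :
  (0 < m)%N -> (0 < n)%N ->
  ((n < m)%N /\ C \in unitmx) \/ ((m < n)%N /\ D \in unitmx) ->
  let Q := sylvester_pencil s A B C D in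
  sylv_inj s A B C D <->
  regular_pencil Q /\ spectral_condition s Q (core_spectrum (Some 0) `|m - n|%N Q).
Proof.
move=> m0 n0 CD1; have [l /pencil_data_swap data] := rect_pencil_data A B n0 m0 CD1.
rewrite distnC; apply: (inj_spectral_criterion data) => l0.
exact: (core_zero_data data).
Qed.

Lemma invertible_square n (M : 'M[F]_n) : invertible_mx M <-> M \in unitmx.
Proof. by split=> [[e]|M1]; [rewrite castmx_id|exists erefl]. Qed.

End Criterion.

Theorem theorem3 (R : realType) (s : star_kind) (m n p q : nat)
    (hm : (0 < m)%N) (hn : (0 < n)%N) (hp : (0 < p)%N) (hq : (0 < q)%N)
    (A : 'M[R[i]]_(p, m)) (B : 'M[R[i]]_(n, q))
    (C : 'M[R[i]]_(p, n)) (D : 'M[R[i]]_(m, q)) :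
  let Q := sylvester_pencil s A B C D in
  (forall E : 'M[R[i]]_(p, q),
     exists! X : 'M[R[i]]_(m, n), A *m X *m B + C *m star s X *m D = E)
  <->
  regular_pencil Q /\
  ([/\ p = m, m <> n, n = q,
       ((m < n)%N /\ invertible_mx A) \/ ((n < m)%N /\ invertible_mx B)
     & spectral_condition s Q (core_spectrum infty `|m - n|%N Q)]
   \/
   [/\ p = n, n <> m, m = q,
       ((n < m)%N /\ invertible_mx C) \/ ((m < n)%N /\ invertible_mx D)
     & spectral_condition s Q (core_spectrum (Some 0) `|m - n|%N Q)]
   \/
   [/\ p = m, m = n, n = q
     & spectral_condition s Q (spectrum Q)]).
Proof.
move=> Q; split=> [S_bij|].
  have [e S_inj] := (sylv_bijP s A B C D).1 S_bij.
  have S_surj : sylv_surj s A B C D.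
    by move=> E; have [X [SX _]] := S_bij E; exists X.
  have [epm|ne_pm] := p =P m; last first.
    have [epn emq inv] := bijective_sizes hm hn e S_inj S_surj ne_pm.
    subst p q; have inv' := inv.
    rewrite !invertible_square in inv'.
    have [reg spec] := (zero_core_criterion s A B hm hn inv').1 S_inj.
    by split=> //; right; left; split=> // enm; apply: ne_pm.
  have enq : n = q by apply/eqP; rewrite -(eqn_pmul2l hm) e epm.
  have [emn|ne_mn] := m =P n.
    subst p q n; have [reg spec] := (square_criterion s A B C D).1 S_inj.
    by split=> //; right; right.
  have e' : (n * m = p * q)%N by rewrite mulnC.
  have S_inj' := (sylv_inj_swap s A B C D).2 S_inj.
  have S_surj' := sylv_surj_swap S_surj.
  have ne_pn : p <> n by rewrite epm.
  have [_ _ inv] := bijective_sizes hn hm e' S_inj' S_surj' ne_pn.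
  subst p q; have inv' := inv.
  rewrite !invertible_square in inv'.
  have [reg spec] := (infty_core_criterion s C D hm hn inv').1 S_inj.
  by split=> //; left.
case=> reg cases; apply/(sylv_bijP s A B C D).
case: cases => [[epm _ enq inv spec]|[[epn _ emq inv spec]|[epm emn enq spec]]].
- subst p q; split=> //; rewrite !invertible_square in inv.
  exact/(infty_core_criterion s C D hm hn inv).
- subst p q; split; first by rewrite mulnC.
  rewrite !invertible_square in inv.
  exact/(zero_core_criterion s A B hm hn inv).
- subst p q n; split=> //.
  exact/(square_criterion s A B C D).
Qed.
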